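(* Let $p$ be a prime, let $R$ be a countable, $p$-reduced, torsion-free ring, and let $B$ be a non-zero free (left) $R$-module that is at most countably generated. Let $(I_n)_{n<\omega}$ be random finite subsets of $B$ and, for $n<\omega$, $b\in I_n$, $\alpha<2^{\aleph_0}$, let $\xi_{n,b}^{\alpha}$ be random $p$-adic integers, distributed as described in the context. Define $$a_n^{\alpha} := \sum_{b\in I_n} b\,\xi_{n,b}^{\alpha}\in J_pB\subseteq\widehat{B},$$ and for every $\emptyset\neq A\subseteq 2^{\aleph_0}$ let $$G^{A} := \big\langle\, B,\ R a_n^{\alpha} : n<\omega,\ \alpha\in A\,\big\rangle_{p*}\subseteq\widehat{B}.$$ Then almost surely the groups $G^A$ have endomorphism ring $\operatorname{End}G^A=R$ and form a fully rigid system; that is, with probability $1$, for all non-empty $A,D\subseteq 2^{\aleph_0}$, $$\operatorname{Hom}(G^{A},G^{D})=\begin{cases}R, & A\subseteq D,\\ 0, & A\nsubseteq D,\end{cases}$$ where $\operatorname{Hom}$ denotes homomorphisms of abelian groups and $R$ is identified with the (left) multiplications $x\mapsto rx$ by elements $r\in R$.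
   Context: A ring or module $X$ is $p$-reduced if $\bigcap_{n=0}^\infty p^nX=0$; a ring is torsion-free if its additive group is. $\widehat{B}$ denotes the $p$-adic completion of $B$ (and $B\subseteq\widehat B$ since $B$ is $p$-reduced); $J_p=\widehat{\mathbb{Z}}$ is the ring of $p$-adic integers; $J_pB$ is the $J_p$-submodule of $\widehat B$ generated by $B$. For a subgroup $X$ of $\widehat B$, $X_{p*}=\{y\in\widehat B : p^ky\in X\text{ for some }k\in\mathbb{N}\}$ is its $p$-purification, and $\langle\cdots\rangle_{p*}$ is the $p$-purification of the subgroup generated by the listed elements and subsets. $2^{\aleph_0}$ is regarded as an index set (the set of ordinals $\alpha<2^{\aleph_0}$). Distribution. The $I_n$ ($n<\omega$) are independent, identically distributed random variables with values in the non-empty finite subsets of $B$, such that for every non-empty finite $F\subseteq B$ and fixed $n$, $\mathbb{P}[F\subseteq I_n]>0$. The $\xi_{n,b}^\alpha$ are obtained as follows. For every finite $0$-$1$ sequence $s$ of length $k$, choose a random integer $a_s$ uniformly distributed on $\{0,1,\dots,p^{2^{k+1}-2^k}-1\}$, all $a_s$ independent; for every infinite $0$-$1$ sequence $f$ put $\xi_f=\sum_{k=0}^\infty p^{2^k-1}a_{f\restriction k}\in J_p$, where $f\restriction k$ is the initial segment of $f$ of length $k$. Fix an injective assignment $(n,b,\alpha)\mapsto f_{n,b,\alpha}$ from $\omega\times B\times 2^{\aleph_0}$ to infinite $0$-$1$ sequences and let $\xi_{n,b}^\alpha:=\xi_{f_{n,b,\alpha}}$. ''Almost surely'' means with probability $1$.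 *)

(* Defs.v *)
From HB Require Import structures.
From mathcomp Require Import all_boot all_order all_algebra finmap.
From mathcomp Require Import generic_quotient ring_quotient.
From mathcomp Require Import all_classical all_reals all_analysis.

Set Implicit Arguments.
Unset Strict Implicit.
Unset Printing Implicit Defensive.

Import Order.TTheory GRing.Theory Num.Theory.
Local Open Scope classical_set_scope.
Local Open Scope ring_scope.
Local Open Scope quotient_scope.

Definition pmultiples (p : nat) (V : zmodType) (n : nat) : set V :=
  range (fun y : V => y *+ p ^ n).
Arguments pmultiples p {V} n.

Definition p_reduced (p : nat) (V : zmodType) : Prop :=
  \bigcap_(n in [set: nat]) pmultiples p n = [set 0 : V].

Definition torsion_free (V : zmodType) : Prop :=
  forall (x : V) (n : nat), (0 < n)%N -> x *+ n = 0 -> x = 0.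

Section FreeModules.
Variables (R : pzRingType) (B : lmodType R).

Definition generates (E : set B) : Prop :=
  forall x : B, exists (s : seq B) (c : B -> R),
    (forall e, e \in s -> E e) /\ x = \sum_(e <- s) c e *: e.

Definition lin_independent (E : set B) : Prop :=
  forall (s : seq B) (c : B -> R), uniq s -> (forall e, e \in s -> E e) ->
    \sum_(e <- s) c e *: e = 0 -> forall e, e \in s -> c e = 0.

Definition free_module : Prop :=
  exists E : set B, lin_independent E /\ generates E.

Definition countably_generated : Prop :=
  exists E : set B, countable E /\ generates E.

End FreeModules.

Arguments free_module {R} B.
Arguments countably_generated {R} B.

Lemma pmultiples_zmod (p : nat) (V : zmodType) (n : nat) (x y : V) :
  pmultiples p n x -> pmultiples p n y -> pmultiples p n (x - y).
Proof. by move=> [u _ <-] [v _ <-]; exists (u - v); rewrite // mulrnBl. Qed.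

Lemma pmultiples0 (p : nat) (V : zmodType) (n : nat) : pmultiples p n (0 : V).
Proof. by exists 0 => //; rewrite mul0rn. Qed.

Lemma pmultiplesD (p : nat) (V : zmodType) (n : nat) (x y : V) :
  pmultiples p n x -> pmultiples p n y -> pmultiples p n (x + y).
Proof. by move=> [u _ <-] [v _ <-]; exists (u + v); rewrite // mulrnDl. Qed.

Lemma mulrzB_pmul (V : zmodType) (x x' y : V) (z z' w : int) (q : nat) :
  y *+ q = x - x' -> w *+ q = z - z' ->
  (y *~ z + x' *~ w) *+ q = x *~ z - x' *~ z'.
Proof.
move=> yE wE; have -> : x' *~ z' = x' *~ z - x' *~ (w *+ q).
  by rewrite wE mulrzBr opprB addrC subrK.
have -> : x *~ z = (y *+ q + x') *~ z by rewrite yE subrK.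
rewrite mulrnDl mulrzDl opprD opprK addrA addrK.
congr (_ + _); first by rewrite !pmulrn -!mulrzA mulrC.
by rewrite !pmulrn mulrzz mulrzA.
Qed.

(* The p-adic completion of V is the group of p-adic Cauchy sequences in V
   modulo the group of p-adic null sequences. *)
Section Completion.
Variables (p : nat) (V : zmodType).

Definition pcauchy_pred : {pred nat -> V} := fun x =>
  `[< forall m, exists N, forall i j, (N <= i)%N -> (N <= j)%N ->
      pmultiples p m (x i - x j) >].

Lemma pcauchy_pred_closed : zmod_closed pcauchy_pred.
Proof.
split=> [|x y /asboolP xP /asboolP yP]; apply/asboolP => m.
  by exists 0%N => i j _ _; rewrite subrr; exact: pmultiples0.
have [N1 xN] := xP m; have [N2 yN] := yP m.
exists (maxn N1 N2) => i j; rewrite !geq_max => /andP[i1 i2] /andP[j1 j2].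
have -> : (x - y) i - (x - y) j = (x i - x j) - (y i - y j).
  by rewrite /= !opprD !opprK addrACA.
by apply: pmultiples_zmod; [exact: xN|exact: yN].
Qed.

HB.instance Definition _ := GRing.isZmodClosed.Build _ pcauchy_pred
  pcauchy_pred_closed.

Record pcauchy := PCauchy { pseq : nat -> V; _ : pseq \in pcauchy_pred }.

HB.instance Definition _ := [isSub for pseq].
HB.instance Definition _ := [Choice of pcauchy by <:].
HB.instance Definition _ := [SubChoice_isSubZmodule of pcauchy by <:].

Definition pnull : {pred pcauchy} := fun x =>
  `[< forall m, exists N, forall i, (N <= i)%N -> pmultiples p m (pseq x i) >].

Lemma pnull_closed : zmod_closed pnull.
Proof.
split=> [|x y /asboolP xP /asboolP yP]; apply/asboolP => m.
  by exists 0%N => i _; exact: pmultiples0.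
have [N1 xN] := xP m; have [N2 yN] := yP m.
exists (maxn N1 N2) => i; rewrite geq_max => /andP[i1 i2].
by apply: pmultiples_zmod; [exact: xN|exact: yN].
Qed.

HB.instance Definition _ := GRing.isZmodClosed.Build _ pnull pnull_closed.

Definition pcompl : Type := Quotient.quot pnull.

HB.instance Definition _ := GRing.Zmodule.on pcompl.

Definition pclass (x : pcauchy) : pcompl := \pi_(Quotient.quot pnull) x.

Definition prepr (x : pcompl) : pcauchy := repr (x : Quotient.quot pnull).

Lemma preprK x : pclass (prepr x) = x.
Proof. exact: reprK. Qed.

Lemma pclassP x y : pclass x = pclass y <-> x - y \in pnull.
Proof.
by rewrite (Quotient.idealrBE pnull); split=> [/eqP|/eqP].
Qed.

Lemma pclassD x y : pclass (x + y) = pclass x + pclass y.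
Proof. exact: (Quotient.pi_add pnull). Qed.

Lemma pcst_subproof (b : V) : (fun=> b) \in pcauchy_pred.
Proof.
apply/asboolP => m; exists 0%N => i j _ _.
by rewrite subrr; exact: pmultiples0.
Qed.

Definition pembed (b : V) : pcompl := pclass (PCauchy (pcst_subproof b)).

Lemma pembed_inj : p_reduced p V -> injective pembed.
Proof.
move=> rV b c /pclassP /asboolP bc; apply/eqP; rewrite -subr_eq0; apply/eqP.
suff : [set 0] (b - c) by [].
rewrite -rV => m _; have [N h] := bc m.
exact: h N (leqnn N).
Qed.

End Completion.

Arguments pcauchy_pred p {V}.
Arguments pclass {p V}.
Arguments prepr {p V}.
Arguments pembed p {V}.

Definition Jp (p : nat) : zmodType := pcompl p int.

Section LeftAction.
Variables (p : nat) (R : pzRingType) (B : lmodType R).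

Lemma lscale_subproof (r : R) (x : pcauchy p B) :
  (fun i => r *: pseq x i) \in pcauchy_pred p.
Proof.
apply/asboolP => m; case: x => x /= /asboolP /(_ m)[N h].
exists N => i j iN jN; have [y _ yE] := h i j iN jN.
by exists (r *: y); rewrite // -scalerBr -yE scalerMnr.
Qed.

Definition lscale (r : R) (x : pcompl p B) : pcompl p B :=
  pclass (PCauchy (lscale_subproof r (prepr x))).

Lemma lscaleE (r : R) (x : pcauchy p B) :
  lscale r (pclass x) = pclass (PCauchy (lscale_subproof r x)).
Proof.
apply/pclassP/asboolP => m.
have /pclassP/asboolP/(_ m)[N h] := preprK (pclass x).
exists N => i iN; have [y _ yE] := h i iN; exists (r *: y) => //=.
by rewrite scalerMnr yE /= scalerBr.
Qed.

Fact lscaleA (r s : R) (x : pcompl p B) :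
  lscale r (lscale s x) = lscale (r * s) x.
Proof.
rewrite -[x]preprK !lscaleE; congr pclass; apply: val_inj.
by apply: funext => i /=; rewrite scalerA.
Qed.

Fact lscale1 : left_id 1 lscale.
Proof.
move=> x; rewrite -[x in RHS]preprK; congr pclass; apply: val_inj.
by apply: funext => i /=; rewrite scale1r.
Qed.

Fact lscaleDr : right_distributive lscale +%R.
Proof.
move=> r x y; rewrite -[x]preprK -[y]preprK -pclassD !lscaleE -pclassD.
congr pclass; apply: val_inj.
by apply: funext => i /=; rewrite scalerDr.
Qed.

Fact lscaleDl (x : pcompl p B) :
  {morph (fun r => lscale r x) : r s / r + s}.
Proof.
move=> r s; rewrite -[x]preprK !lscaleE -pclassD.
congr pclass; apply: val_inj.
by apply: funext => i /=; rewrite scalerDl.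
Qed.

HB.instance Definition _ := GRing.Zmodule_isLmodule.Build R (pcompl p B)
  lscaleA lscale1 lscaleDr lscaleDl.

End LeftAction.

Section PadicAction.
Variables (p : nat) (V : zmodType).

Lemma pscale_subproof (z : pcauchy p int) (x : pcauchy p V) :
  (fun i => pseq x i *~ pseq z i) \in pcauchy_pred p.
Proof.
apply/asboolP => m; case: x => x /= /asboolP /(_ m)[N h].
case: z => z /= /asboolP /(_ m)[M k].
exists (maxn N M) => i j; rewrite !geq_max => /andP[iN iM] /andP[jN jM].
have [y _ yE] := h i j iN jN; have [w _ wE] := k i j iM jM.
exists (y *~ z i + x j *~ w) => //.
exact: mulrzB_pmul.
Qed.

Definition pscale (z : Jp p) (x : pcompl p V) : pcompl p V :=
  pclass (PCauchy (pscale_subproof (prepr z) (prepr x))).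

Lemma pscaleE (z : pcauchy p int) (x : pcauchy p V) :
  pscale (pclass z) (pclass x) = pclass (PCauchy (pscale_subproof z x)).
Proof.
apply/pclassP/asboolP => m.
have /pclassP/asboolP/(_ m)[M k] := preprK (pclass z).
have /pclassP/asboolP/(_ m)[N h] := preprK (pclass x).
exists (maxn N M) => i; rewrite geq_max => /andP[iN iM].
have [y _ yE] := h i iN; have [w _ wE] := k i iM.
exists (y *~ pseq (prepr (pclass z)) i + pseq x i *~ w) => //.
exact: mulrzB_pmul.
Qed.

End PadicAction.

(* xi p c is the sum in J_p of the series with terms p^(2^k - 1) c_k, that is,
   the class of its sequence of partial sums. *)
Section PadicSeries.
Variables (p : nat) (c : nat -> nat).

Definition xi_psum (n : nat) : int :=
  \sum_(0 <= k < n) (p ^ (2 ^ k - 1) * c k)%N%:Z.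

Lemma xi_subproof : xi_psum \in pcauchy_pred p.
Proof.
have tail m i : (m <= i)%N -> pmultiples p m (xi_psum i - xi_psum m).
  move=> mi; rewrite /xi_psum (big_cat_nat (leq0n m) mi) //= addrAC subrr add0r.
  rewrite big_nat; apply: (big_ind (pmultiples p m)).
  - exact: pmultiples0.
  - exact: pmultiplesD.
  move=> k /andP[mk _].
  have mk2 : (m <= 2 ^ k - 1)%N.
    by apply: (leq_trans mk); rewrite leq_subRL ?expn_gt0// add1n ltn_expl.
  exists (p ^ (2 ^ k - 1 - m) * c k)%N%:Z => //.
  by rewrite -mulr_natr -natz -natrM natz mulnAC -expnD subnK.
apply/asboolP => m; exists m => i j mi mj.
rewrite -[xi_psum i - _](subrKA (xi_psum m)) -[xi_psum m - _]opprB.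
by apply: pmultiples_zmod; exact: tail.
Qed.

Definition xi : Jp p := pclass (PCauchy xi_subproof).

End PadicSeries.

Section PureSubgroups.
Variables (p : nat) (V : zmodType).

Definition is_subgroup (X : set V) : Prop :=
  X 0 /\ forall x y, X x -> X y -> X (x - y).

Definition ppurification (X : set V) : set V :=
  [set y | exists k : nat, X (y *+ p ^ k)].

Definition pure_span (S : set V) : {pred V} :=
  fun y => `[< ppurification (smallest is_subgroup S) y >].

Lemma pure_span_closed (S : set V) : zmod_closed (pure_span S).
Proof.
have sg0 : smallest is_subgroup S 0 by move=> X [[]].
have sgB x y : smallest is_subgroup S x -> smallest is_subgroup S y ->
    smallest is_subgroup S (x - y).
  by move=> Sx Sy X XP; apply: (XP.1.2); [exact: Sx|exact: Sy].
have sgM x n : smallest is_subgroup S x -> smallest is_subgroup S (x *+ n).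
  move=> Sx; elim: n => [|n IH]; rewrite ?mulr0n // mulrS addrC.
  rewrite -[x in _ + x]opprK; apply: (sgB) => //.
  by rewrite -sub0r; exact: sgB.
split=> [|x y /asboolP[k xk] /asboolP[l yl]]; apply/asboolP.
  by exists 0%N; rewrite mul0rn.
exists (k + l)%N; rewrite mulrnBl; apply: (sgB).
  by rewrite expnD mulrnA; exact: sgM.
by rewrite expnD mulnC mulrnA; exact: sgM.
Qed.

HB.instance Definition _ (S : set V) := GRing.isZmodClosed.Build _
  (pure_span S) (pure_span_closed S).

Record pure_group (S : set V) :=
  PureGroup { pgval : V; _ : pgval \in pure_span S }.

Section PureGroupStructure.
Variable S : set V.
HB.instance Definition _ := [isSub for @pgval S].
HB.instance Definition _ := [Choice of pure_group S by <:].
HB.instance Definition _ := [SubChoice_isSubZmodule of pure_group S by <:].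
End PureGroupStructure.

End PureSubgroups.

Arguments pure_group p {V} S.
Arguments pgval {p V S}.

Definition generatorsG (p : nat) (R : pzRingType) (B : lmodType R) (K : Type)
    (a : nat -> K -> pcompl p B) (A : set K) : set (pcompl p B) :=
  range (pembed p : B -> pcompl p B) `|`
    [set x | exists (r : R) n al, A al /\ x = r *: a n al].

Notation groupG p a A := (pure_group p (generatorsG a A)).

Section Hom.
Variables (p : nat) (R : pzRingType) (B : lmodType R).
Variables (K : Type) (a : nat -> K -> pcompl p B) (A D : set K).

(* Hom(G, H) = R, every r being identified with the map x |-> r x. *)
Definition hom_eq_ring : Prop :=
  (forall r : R, exists phi : {additive groupG p a A -> groupG p a D},
     forall x, pgval (phi x) = r *: pgval x) /\
  (forall phi : {additive groupG p a A -> groupG p a D},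
     exists! r : R, forall x, pgval (phi x) = r *: pgval x).

Definition hom_eq_zero : Prop :=
  forall (phi : {additive groupG p a A -> groupG p a D}) x, phi x = 0.

End Hom.

Section Random.
Context {d : measure_display} {T : measurableType d} {F : realType}.
Variable P : probability T F.

(* S is meant to be countable and carries the discrete sigma-algebra; this is
   also the sigma-algebra used for independence below. *)
Definition discrete_rv (S : Type) (X : T -> S) : Prop :=
  forall C : set S, measurable (X @^-1` C).

Definition independent_rvs (J : eqType) (S : Type) (X : J -> T -> S) : Prop :=
  forall (s : seq J) (C : J -> set S), uniq s ->
    P (\bigcap_(j in [set` s]) (X j @^-1` C j)) =
    (\prod_(j <- s) P (X j @^-1` C j))%E.

Definition identically_distributed (J S : Type) (X : J -> T -> S) : Prop :=
  forall i j (C : set S), P (X i @^-1` C) = P (X j @^-1` C).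

Definition uniform_below (N : nat) (X : T -> nat) : Prop :=
  forall i, (i < N)%N -> P (X @^-1` [set i]) = (N%:R^-1)%:E.

End Random.

(* Main.v *)
(* Call the variables xi_(n,b)^al "independent" if xi_v S + Q = 0 forces S = 0
   whenever S and Q are values at the other variables of polynomials with
   coefficients in B. Almost surely this holds for all such v, S and Q at once:
   there are countably many polynomials with prescribed initial segments of the
   sequences f, at level k there are at most 2^(k m) ways to continue m initial
   segments, and given all other digits at most p^N of the p^(2^k) values of
   the digit of xi_v at level k solve S xi_v + Q = 0 modulo p^(2^(k+1)-1),
   where p^N does not divide S. Since 2^(k m) p^N / p^(2^k) tends to 0, the
   union bound suffices.

   Let phi : G^A -> G^D, let al be in A, and note that
   phi(a_n^al) = sum_(b in I_n) xi_(n,b)^al phi(b). Up to powers of p, phi(b)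
   and phi(a_n^al) are combinations of B and of the r a_m^be. Independence shows
   that only a_n^al can occur in phi(b) for b in I_n. Almost surely b lies in
   infinitely many I_n, so phi(b) is in B; comparing the coefficients of
   xi_(n,b)^al gives p^k phi(b) = rho b for all b in I_n, with rho = 0 unless
   al is in D. As I_n contains any given pair of elements for some n, phi is a
   multiplication by an element of R on B, and B is p-dense in G^A. *)

Require Import Defs.
From HB Require Import structures.
From mathcomp Require Import all_boot all_order all_algebra finmap.
From mathcomp Require Import all_classical all_reals all_analysis.
From mathcomp Require Import zify.

Set Implicit Arguments.
Unset Strict Implicit.
Unset Printing Implicit Defensive.

Import Order.TTheory GRing.Theory Num.Theory.
Import numFieldNormedType.Exports.
Local Open Scope classical_set_scope.
Local Open Scope ring_scope.

(** * p-divisibility in torsion-free groups *)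

(** [e] decodes [h] on [E], and [x0] only makes the decoding total. Countable data can thus be
    replaced by natural numbers in a concrete countable type. *)
Lemma countable_enum (X : Type) (x0 : X) (E : set X) : countable E ->
  exists (h : X -> nat) (e : nat -> X), forall x, E x -> e (h x) = x.
Proof.
move=> /countable_injP[h hI]; exists h.
have /choice[e eP] n : exists x, forall y, E y -> h y = n -> x = y.
  have [[y [Ey yn]]|nE] := pselect (exists y, E y /\ h y = n).
    by exists y => z Ez zn; apply: hI; rewrite ?inE // yn zn.
  by exists x0 => y Ey yn; case: nE; exists y.
by exists e => x Ex; exact: eP.
Qed.

Section PMultiples.
Variables (p : nat) (V : zmodType).
Implicit Types x y : V.

Lemma pmultiples_le m n x : (m <= n)%N -> pmultiples p n x -> pmultiples p m x.
Proof.
move=> mn [y _ <-]; exists (y *+ p ^ (n - m)) => //.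
by rewrite -mulrnA -expnD subnK.
Qed.

Lemma pmultiplesN n x : pmultiples p n x -> pmultiples p n (- x).
Proof. by rewrite -sub0r; apply: pmultiples_zmod; exact: pmultiples0. Qed.

Lemma pmultiples_sum (J : Type) (s : seq J) (G : J -> V) n :
  (forall j, pmultiples p n (G j)) -> pmultiples p n (\sum_(j <- s) G j).
Proof.
move=> GP; apply: big_ind => //; first exact: pmultiples0.
exact: pmultiplesD.
Qed.

Lemma pmultiples_congr n x y :
  pmultiples p n (x - y) -> pmultiples p n x -> pmultiples p n y.
Proof.
move=> xy xn; have -> : y = x - (x - y) by rewrite subKr.
exact: pmultiples_zmod.
Qed.

Hypotheses (p_pr : prime p) (tfV : torsion_free V).

Let expp_gt0 n : (0 < p ^ n)%N. Proof. by rewrite expn_gt0 prime_gt0. Qed.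

Lemma mulrnI_tf n x y : (0 < n)%N -> x *+ n = y *+ n -> x = y.
Proof.
move=> n0 xy; apply/eqP; rewrite -subr_eq0; apply/eqP; apply: (tfV n0).
by rewrite mulrnBl xy subrr.
Qed.

Lemma pmultiplesI m n x : pmultiples p (m + n) (x *+ p ^ m) -> pmultiples p n x.
Proof.
move=> [y _]; rewrite addnC expnD mulrnA => /mulrnI_tf <- //; by exists y.
Qed.

(* By Bezout, [p ^ n] divides [x *+ gcdn u (p ^ n)], and the gcd is a power of
   [p]. *)
Lemma dvdn_of_pmultiples n N x u : (N <= n)%N -> ~ pmultiples p N x ->
  pmultiples p n (x *+ u) -> (p ^ (n - N) %| u)%N.
Proof.
move=> Nn xN xu.
have /(dvdn_pfactor _ _ p_pr)[v vn gE] := dvdn_gcdr u (p ^ n).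
have xv : pmultiples p n (x *+ p ^ v).
  rewrite -gE; have [z _ zE] := xu.
  have [->|u0] := posnP u.
    by rewrite gcd0n; exists x.
  case: (egcdnP (p ^ n) u0) => km kn kE _; exists (z *+ km - x *+ kn) => //.
  rewrite mulrnBl mulrnAC zE -!mulrnA [(u * km)%N]mulnC kE mulrnDr.
  by rewrite addrAC subrr add0r.
have nv : (n - N <= v)%N.
  rewrite leqNgt; apply/negP => vlt; apply: xN.
  apply: (@pmultiplesI v); apply: (pmultiples_le _ xv); lia.
by apply: dvdn_trans (dvdn_gcdl u (p ^ n)); rewrite gE dvdn_exp2l.
Qed.

(** Two solutions differ by a multiple of p^(n-N): subtracting the conditions and cancelling p^M
    leaves p^n dividing (i-j)x, where p^N does not divide x. Hence the quotient by p^(n-N), which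
    takes at most p^N values, is injective on the solutions. *)
Lemma card_solutions (n M N : nat) (x y : V) (z : int) :
  (N <= n)%N -> ~ pmultiples p N x ->
  (#|[set i : 'I_(p ^ n) |
      `[< pmultiples p (M + n) (x *~ (z + (p ^ M * i)%N%:Z) + y)%R >]]%SET| <= p ^ N)%N.
Proof.
move=> Nn xN.
have q0 := expp_gt0 (n - N).
have lt_q (i : 'I_(p ^ n)) : (i %/ p ^ (n - N) < p ^ N)%N.
  by rewrite ltn_divLR // -expnD subnKC.
pose h (i : 'I_(p ^ n)) : 'I_(p ^ N) := Ordinal (lt_q i).
rewrite -[leqRHS]card_ord; set S := [set _ | _]%SET.
rewrite -(card_in_imset (f := h) (D := mem S)) ?max_card //.
suff dv (i j : 'I_(p ^ n)) : i \in S -> j \in S -> (j <= i)%N -> (p ^ (n - N) %| i - j)%N.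
  have inj (i j : 'I_(p ^ n)) : i \in S -> j \in S -> (j <= i)%N -> h i = h j -> i = j.
    move=> iS jS ji [hij]; apply: val_inj => /=.
    rewrite (divn_eq i (p ^ (n - N))) (divn_eq j (p ^ (n - N))) hij.
    by congr (_ + _)%N; apply/eqP; rewrite eqn_mod_dvd // dv.
  move=> i j iS jS; case: (leqP j i) => [|/ltnW] ij hij; first exact: inj.
  by apply/esym/inj.
rewrite !inE => /asboolP/asboolP iP /asboolP/asboolP jP ji.
apply: (dvdn_of_pmultiples Nn xN); apply: (@pmultiplesI M).
have := pmultiples_zmod iP jP; congr (pmultiples _ _ _).
rewrite opprD addrACA subrr addr0 -mulrzBr opprD addrACA subrr add0r.
rewrite -mulrnA pmulrn; congr (_ *~ _).
by rewrite subzn ?leq_mul2l ?ji ?orbT // -mulnBr mulnC.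
Qed.

End PMultiples.

(** * The p-adic completion *)

Section CompletionTheory.
Variables (p : nat) (V : zmodType).
Implicit Types (x y : pcauchy p V) (b : V).

Lemma pclass_zmod_morphism : zmod_morphism (@pclass p V).
Proof.
have D := @pclassD p V; move=> x y; apply/(addIr (pclass y)).
by rewrite -D !subrK.
Qed.

HB.instance Definition _ :=
  GRing.isZmodMorphism.Build (pcauchy p V) (pcompl p V) (@pclass p V)
    pclass_zmod_morphism.

Lemma pseqB x y i : pseq (x - y) i = pseq x i - pseq y i.
Proof. by []. Qed.

Lemma pseqMn x n i : pseq (x *+ n) i = pseq x i *+ n.
Proof. by elim: n => // n IH; rewrite !mulrS -IH. Qed.

Lemma pcauchyP x m : exists N, forall i j, (N <= i)%N -> (N <= j)%N ->
  pmultiples p m (pseq x i - pseq x j).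
Proof. by case: x => x /= /asboolP. Qed.

Lemma pclass_eq0 x : pclass x = 0 <->
  forall m, exists N, forall i, (N <= i)%N -> pmultiples p m (pseq x i).
Proof.
rewrite -(raddf0 (@pclass p V)); split=> [/pclassP|h].
  by rewrite subr0 => /asboolP.
by apply/pclassP; rewrite subr0; apply/asboolP.
Qed.

Lemma eq_pclass x y : (forall i, pseq x i = pseq y i) -> pclass x = pclass y.
Proof. by move=> xy; congr pclass; apply/val_inj/funext. Qed.

Lemma pembed_zmod_morphism : zmod_morphism (@pembed p V).
Proof. by move=> b c; rewrite /pembed -raddfB; exact: eq_pclass. Qed.

HB.instance Definition _ :=
  GRing.isZmodMorphism.Build V (pcompl p V) (@pembed p V) pembed_zmod_morphism.

Lemma pscale_zmod_morphism (z : Jp p) : zmod_morphism (@pscale p V z).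
Proof.
move=> u v; rewrite -[z]preprK -[u]preprK -[v]preprK -raddfB !pscaleE -raddfB.
by apply: eq_pclass => i; rewrite /= mulrzBl.
Qed.

HB.instance Definition _ (z : Jp p) :=
  GRing.isZmodMorphism.Build (pcompl p V) (pcompl p V) (@pscale p V z)
    (pscale_zmod_morphism z).

Hypotheses (p_pr : prime p) (tfV : torsion_free V).

Let expp_gt0 n : (0 < p ^ n)%N. Proof. by rewrite expn_gt0 prime_gt0. Qed.

(** The termwise quotients by p^m, from index [N] on, again form a Cauchy sequence: precision m+n
    for [x] becomes precision n after division in a torsion-free group. *)
Lemma pmultiples_pclass x m N :
  (forall i, (N <= i)%N -> pmultiples p m (pseq x i)) ->
  pmultiples p m (pclass x).
Proof.
move=> xm; have /choice[y yE] i : exists y : V, pseq x (N + i) = y *+ p ^ m.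
  by have [y _ <-] := xm _ (leq_addr i N); exists y.
have yC : y \in pcauchy_pred p.
  apply/asboolP => n; have [M xM] := pcauchyP x (m + n).
  exists M => i j Mi Mj; apply: (pmultiplesI p_pr tfV (m := m)).
  by rewrite mulrnBl -!yE; apply: xM; exact: (leq_trans _ (leq_addl _ _)).
exists (pclass (PCauchy yC)) => //; rewrite -raddfMn; apply/pclassP/asboolP => n.
have [M xM] := pcauchyP x n; exists M => i Mi.
by rewrite pseqB pseqMn /= -yE; apply: xM => //; exact: (leq_trans _ (leq_addl _ _)).
Qed.

Lemma pembed_dense (u : pcompl p V) m :
  exists b, pmultiples p m (u - pembed p b).
Proof.
rewrite -[u]preprK; have [N xN] := pcauchyP (prepr u) m.
exists (pseq (prepr u) N); rewrite /pembed -raddfB.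
by apply: (@pmultiples_pclass _ _ N) => i Ni; exact: xN.
Qed.

(** [k] is a late term of a Cauchy sequence for [z] and so serves all [u] at once; an element and
    its image under a homomorphism can be approximated with the same integer. *)
Lemma pscale_approx (z : Jp p) m : exists k : int, forall u : pcompl p V,
  pmultiples p m (pscale z u - u *~ k).
Proof.
rewrite -[z]preprK; set c := prepr z.
have /asboolP/(_ m)[N cN] : pseq c \in pcauchy_pred p by case: c.
exists (pseq c N) => u; rewrite -[u]preprK pscaleE.
rewrite -raddfMz -raddfB; apply: (@pmultiples_pclass _ _ N) => i Ni.
rewrite pseqB /=; set x := prepr u.
have -> : pseq (x *~ pseq c N) i = pseq x i *~ pseq c N.
  by case: (pseq c N) => n; rewrite ?NegzE ?mulrNz -!pmulrn -?pseqMn.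
rewrite -mulrzBr; have [w _ <-] := cN i N Ni (leqnn N).
by exists (pseq x i *~ w) => //; rewrite !pmulrn -mulrzA mulrzz mulrC.
Qed.

Lemma pcompl_reduced (u : pcompl p V) : (forall m, pmultiples p m u) -> u = 0.
Proof.
rewrite -[u]preprK => um; apply/pclass_eq0 => m.
have [v _] := um m; rewrite -[v]preprK -raddfMn => /pclassP/asboolP/(_ m)[N h].
exists N => i /h; rewrite pseqB pseqMn => /pmultiples_congr; apply.
by exists (pseq (prepr v) i).
Qed.

Lemma pcompl_tf (u : pcompl p V) k : u *+ p ^ k = 0 -> u = 0.
Proof.
rewrite -[u]preprK -raddfMn => /pclass_eq0 uk; apply/pclass_eq0 => m.
have [N h] := uk (k + m)%N; exists N => i /h; rewrite pseqMn.
exact: pmultiplesI.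
Qed.

Lemma pcompl_Ip (u v : pcompl p V) k : u *+ p ^ k = v *+ p ^ k -> u = v.
Proof.
move=> uv; apply/eqP; rewrite -subr_eq0; apply/eqP/(@pcompl_tf _ k).
by rewrite mulrnBl uv subrr.
Qed.

(** A late term of a sequence for [u] shows that p^k divides [b] already in [V], and p^k can be
    cancelled in the completion. *)
Lemma pembed_pure (u : pcompl p V) b k :
  u *+ p ^ k = pembed p b -> exists c, u = pembed p c.
Proof.
move=> uE; move: (uE); rewrite -{1}[u]preprK -raddfMn.
move=> /pclassP/asboolP/(_ k)[N /(_ N (leqnn N))].
rewrite pseqB pseqMn /= => h.
have [c _ cE] : pmultiples p k b.
  by apply: (pmultiples_congr h); exists (pseq (prepr u) N).
by exists c; apply: (@pcompl_Ip _ _ k); rewrite uE -cE raddfMn.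
Qed.

End CompletionTheory.

Lemma pscaleC (p : nat) (V : zmodType) (z z' : Jp p) (u : pcompl p V) :
  pscale z (pscale z' u) = pscale z' (pscale z u).
Proof.
rewrite -[z]preprK -[z']preprK -[u]preprK !pscaleE.
by apply: eq_pclass => i /=; rewrite mulrzAC.
Qed.

Section LeftScale.
Variables (p : nat) (R : pzRingType) (B : lmodType R).

Lemma scale_pembed (r : R) (b : B) : r *: pembed p b = pembed p (r *: b).
Proof. by rewrite /pembed [LHS]lscaleE; exact: eq_pclass. Qed.

Lemma scale_pscale (r : R) z (u : pcompl p B) :
  r *: pscale z u = pscale z (r *: u).
Proof.
rewrite -[z]preprK -[u]preprK pscaleE [LHS]lscaleE.
rewrite [r *: pclass _]lscaleE pscaleE; apply: eq_pclass => i /=.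
by rewrite scalerMzr.
Qed.

End LeftScale.

(* Polynomials with coefficients in [V] and variables in [X]: lists of pairs
   of a coefficient and a word of variables. *)
Section Polynomials.
Variables (p : nat) (V : zmodType) (X : eqType).
Implicit Types (L : seq (V * seq X)).

Definition mono_int (x : X -> int) (m : V * seq X) : V :=
  foldr (fun v b => b *~ x v) m.1 m.2.

Definition poly_int (x : X -> int) L : V := \sum_(m <- L) mono_int x m.

Definition mono_padic (x : X -> Jp p) (m : V * seq X) : pcompl p V :=
  foldr (fun v u => pscale (x v) u) (pembed p m.1) m.2.

Definition poly_padic (x : X -> Jp p) L : pcompl p V :=
  \sum_(m <- L) mono_padic x m.

Definition pvars L : seq X := flatten [seq m.2 | m <- L].

Lemma pvars_cat L L' : pvars (L ++ L') = pvars L ++ pvars L'.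
Proof. by rewrite /pvars map_cat flatten_cat. Qed.

Lemma pvars_linear (Y : Type) (s : seq Y) (c : Y -> V) (h : Y -> X) :
  pvars [seq (c u, [:: h u]) | u <- s] = [seq h u | u <- s].
Proof. by elim: s => //= u s <-. Qed.

Lemma poly_padic_cat x L L' :
  poly_padic x (L ++ L') = poly_padic x L + poly_padic x L'.
Proof. exact: big_cat. Qed.

Lemma eq_poly_int x y L : {in pvars L, x =1 y} -> poly_int x L = poly_int y L.
Proof.
rewrite /poly_int; elim: L => [|m L IH] xy; first by rewrite !big_nil.
rewrite !big_cons IH => [|v vL]; last first.
  by apply: xy; rewrite /pvars /= mem_cat vL orbT.
congr (_ + _); rewrite /mono_int.
have {IH} : {in m.2, x =1 y}.
  by move=> v vm; apply: xy; rewrite /pvars /= mem_cat vm.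
elim: m.2 => //= v s IH h.
by rewrite IH => [|u us]; rewrite h ?inE ?us ?eqxx ?orbT.
Qed.

(** The operations act termwise on representing sequences, so vanishing of p-adic values reduces to
    divisibility of values at integers. *)
Lemma poly_padicE (z : X -> pcauchy p int) L :
  exists2 c : pcauchy p V, poly_padic (pclass \o z) L = pclass c &
    forall i, pseq c i = poly_int (fun v => pseq (z v) i) L.
Proof.
rewrite /poly_padic /poly_int; elim: L => [|m L [c cE ci]].
  by exists 0 => [|i]; rewrite !big_nil ?raddf0.
have [e eE ei] : exists2 c : pcauchy p V, mono_padic (pclass \o z) m = pclass c &
    forall i, pseq c i = mono_int (fun v => pseq (z v) i) m.
  rewrite /mono_padic /mono_int; elim: m.2 => [|v s [e eE ei]] /=.
    by exists (PCauchy (pcst_subproof p m.1)).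
  exists (PCauchy (pscale_subproof (z v) e)) => [|i /=].
    by rewrite eE pscaleE.
  by rewrite ei.
exists (e + c) => [|i]; rewrite !big_cons ?cE ?eE ?raddfD //.
by rewrite -ei -ci.
Qed.

End Polynomials.

Lemma poly_int_map (V : zmodType) (X Y : eqType) (h : X -> Y) (x : Y -> int)
    (L : seq (V * seq X)) :
  poly_int x [seq (m.1, map h m.2) | m <- L] = poly_int (x \o h) L.
Proof.
rewrite /poly_int big_map; apply: eq_bigr => m _.
by rewrite /mono_int /=; elim: m.2 => //= v s ->.
Qed.

Lemma poly_padic_map (p : nat) (V : zmodType) (X Y : eqType) (h : X -> Y)
    (x : Y -> Jp p) (L : seq (V * seq X)) :
  poly_padic x [seq (m.1, map h m.2) | m <- L] = poly_padic (x \o h) L.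
Proof.
rewrite /poly_padic big_map; apply: eq_bigr => m _.
by rewrite /mono_padic /=; elim: m.2 => //= v s ->.
Qed.

Lemma pvars_map (V : zmodType) (X Y : eqType) (h : X -> Y) (L : seq (V * seq X)) :
  pvars [seq (m.1, map h m.2) | m <- L] = map h (pvars L).
Proof. by rewrite /pvars map_flatten -!map_comp. Qed.

(** * Probability estimates *)

Section AlmostSure.
Context {d : measure_display} {T : measurableType d} {F : realType}.
Variable P : probability T F.

Lemma negligible_countable_bigcup (X : Type) (Q : X -> set T) :
  countable [set: X] -> (forall x, P.-negligible (Q x)) ->
  P.-negligible [set w | exists x, Q x w].
Proof.
move=> /countable_injP[h hI] Qn.
apply: (@negligibleS _ _ _ _ (\bigcup_n [set w | exists2 x, h x = n & Q x w])).
  by move=> w [x xw]; exists (h x) => //; exists x.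
apply: negligible_bigcup => n.
have [[x xn]|nx] := pselect (exists x, h x = n).
  apply: negligibleS (Qn x) => w [y yn yw].
  by rewrite (hI x y) ?inE // xn yn.
apply: negligibleS (negligible_set0 P) => w [y yn _].
by apply: nx; exists y.
Qed.

(** [Q] need not be measurable: the intersection of its covers is a measurable null set containing
    it. *)
Lemma negligible_le_pow2 (Q : set T) :
  (forall j : nat, exists E, [/\ measurable E, Q `<=` E &
    (P E <= ((2 ^+ j)^-1)%:E)%E]) -> P.-negligible Q.
Proof.
move=> /choice[E EP]; exists (\bigcap_j E j).
have mE : measurable (\bigcap_j E j).
  by apply: bigcap_measurable => // j _; have [] := EP j.
split=> //; last by move=> w Qw j _; have [_ h _] := EP j; exact: h.
apply/eqP; rewrite eq_le measure_ge0 andbT; apply/lee_addgt0Pr => e e0.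
rewrite add0e; pose j := Num.bound e^-1.
have je : (2 ^+ j)^-1 <= e.
  rewrite invf_ple ?posrE ?exprn_gt0 //.
  apply: (le_trans (ltW (archi_boundP _))); first by rewrite invr_ge0 ltW.
  by rewrite -natrX ler_nat -/j ltnW // ltn_expl.
have [mEj _ Pj] := EP j.
apply: (@le_trans _ _ (P (E j))).
  by apply: le_measure; rewrite ?inE // => w; exact.
by apply: (le_trans Pj); rewrite lee_fin.
Qed.

Section Independence.
Variables (J : eqType) (X : J -> T -> nat).
Hypotheses (Xd : forall j, discrete_rv (X j)) (Xi : independent_rvs P X).

Lemma uniform_prob_le (n c : nat) (u : J) (C : set nat) : (0 < n)%N ->
  uniform_below P n (X u) -> (#|[set i : 'I_n | `[< C i >]]%SET| <= c)%N ->
  (P (X u @^-1` C) <= (c%:R / n%:R)%:E)%E.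
Proof.
move=> n0 Xu Cc.
pose G (i : nat) := X u @^-1` [set i].
have mG i : measurable (G i) by exact: Xd.
have tG : trivIset setT G by move=> i j _ _ [w [/= <- <-]].
have PG (i : 'I_n) : P (G i) = (n%:R^-1)%:E by exact: Xu.
(* [uniform_below] prescribes only the values below [n]; these already carry total mass 1, so the
   larger values have probability 0. *)
pose big := X u @^-1` [set x | (n <= x)%N].
have mbig : measurable big by exact: Xd.
have Pbig : P big = 0%E.
  have -> : big = ~` \big[setU/set0]_(i < n) G i.
    rewrite -bigcup_mkord; apply/seteqP; split=> w.
      by rewrite /big /= leqNgt => /negP nw [i /= ltin wi]; apply: nw; rewrite wi.
    move=> h; rewrite /big /= leqNgt; apply/negP => lt.
    by apply: h; exists (X u w).
  rewrite probability_setC; last by apply: bigsetU_measurable.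
  rewrite measure_bigsetU // (eq_bigr (fun=> (n%:R^-1)%:E)); last by move=> i _; exact: PG.
  rewrite sumEFin sumr_const card_ord -[_ *+ n]mulr_natr mulVf ?subee //.
  by rewrite pnatr_eq0 -lt0n.
pose GC i := if `[< C i >] then G i else set0.
have mGC i : measurable (GC i) by rewrite /GC; case: ifP.
have mU : measurable (\big[setU/set0]_(i < n) GC i) by exact: bigsetU_measurable.
have sub : X u @^-1` C `<=` big `|` \big[setU/set0]_(i < n) GC i.
  move=> w /= wC; have [lt|] := ltnP (X u w) n; last by left.
  by right; rewrite -bigcup_mkord; exists (X u w); rewrite // /GC asboolT.
apply: (@le_trans _ _ (P (big `|` \big[setU/set0]_(i < n) GC i))).
  by apply: le_measure; rewrite ?inE //; [exact: Xd|exact: measurableU].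
apply: (@le_trans _ _ (P big + P (\big[setU/set0]_(i < n) GC i))%E).
  exact: measureU2.
rewrite Pbig add0e; apply: (@le_trans _ _ (\sum_(i < n) P (GC i))%E).
  exact: Boole_inequality.
rewrite (eq_bigr (fun i : 'I_n => (if `[< C i >] then n%:R^-1 else 0)%:E)); last first.
  by move=> i _; rewrite /GC; case: ifP => // _; rewrite measure0.
rewrite sumEFin -big_mkcond /= sumr_const lee_fin.
rewrite -[_ *+ _]mulr_natl ler_wpM2r ?invr_ge0 ?ler0n // ler_nat.
by move: Cc; rewrite cardsE.
Qed.

(* Conditionally on the values of the [X j] with [j] in [W], only few values
   of [X u] are bad. *)
Lemma independent_bad_le (n c : nat) (u : J) (W : seq J)
    (bad : seq nat -> nat -> Prop) : (0 < n)%N -> uniq (u :: W) ->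
  uniform_below P n (X u) ->
  (forall y, #|[set i : 'I_n | `[< bad y i >]]%SET| <= c)%N ->
  exists E, [/\ measurable E,
    [set w | bad [seq X j w | j <- W] (X u w)] `<=` E &
    (P E <= (c%:R / n%:R)%:E)%E].
Proof.
move=> n0 uW Xu badc.
(* The event that the variables of [W] take the values [y]. Lists of the wrong length get the empty
   event, so that different lists always give disjoint events. *)
pose H (y : seq nat) : set T := if size y == size W
  then \bigcap_(j in [set` W]) (X j @^-1` [set nth 0%N y (index j W)]) else set0.
have mH y : measurable (H y).
  rewrite /H; case: ifP => // _.
  by apply: fin_bigcap_measurable => [|j _]; [exact: finite_seq|exact: Xd].
have HE w y : H y w -> y = [seq X j w | j <- W].
  rewrite /H; case: ifP => // /eqP sy Hw.
  apply: (@eq_from_nth _ 0%N) => [|i]; first by rewrite size_map.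
  rewrite sy => iW; have [j0 _] : exists j, j \in W by case: (W) iW => // j s _; exists j; rewrite inE eqxx.
  rewrite (nth_map j0) //; have := Hw _ (mem_nth j0 iW); rewrite /= => ->.
  by rewrite index_uniq //; case/andP: uW.
have Hmap w : H [seq X j w | j <- W] w.
  rewrite /H size_map eqxx => j /= jW.
  by rewrite (nth_map j) ?index_mem // nth_index.
have PH y C : P (H y `&` X u @^-1` C) = (P (H y) * P (X u @^-1` C))%E.
  rewrite /H; case: ifP => _; last by rewrite set0I measure0 mul0e.
  pose D j := if j == u then C else [set nth 0%N y (index j W)].
  have DW j : j \in W -> D j = [set nth 0%N y (index j W)].
    by rewrite /D; case: eqP => // -> uinW; move: uW; rewrite /= uinW.
  have HD : \bigcap_(j in [set` W]) (X j @^-1` [set nth 0%N y (index j W)]) =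
      \bigcap_(j in [set` W]) (X j @^-1` D j).
    by apply: eq_bigcapr => j /= jW; rewrite DW.
  have Du : D u = C by rewrite /D eqxx.
  have -> : \bigcap_(j in [set` W]) (X j @^-1` [set nth 0%N y (index j W)]) `&`
      X u @^-1` C = \bigcap_(j in [set` u :: W]) (X j @^-1` D j).
    rewrite HD; apply/seteqP; split=> w.
      by move=> [Hw uw] j; rewrite /= inE => /orP[/eqP ->|/Hw]; rewrite ?Du.
    move=> Hw; split=> [j /= jW|]; first by apply: Hw; rewrite /= inE jW orbT.
    by rewrite -Du; apply: Hw; rewrite /= inE eqxx.
  rewrite Xi // big_cons Du muleC HD Xi //.
  by case/andP: uW.
(* The lists of values are numbered by [pickle], so that countable additivity applies. *)
pose G (k : nat) : set T :=
  if choice.pickle_inv k is Some y then H y `&` X u @^-1` (bad y) else set0.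
pose HH (k : nat) : set T := if choice.pickle_inv k is Some y then H y else set0.
have mG k : measurable (G k).
  by rewrite /G; case: choice.pickle_inv => // y; apply: measurableI => //; exact: Xd.
have mHH k : measurable (HH k) by rewrite /HH; case: choice.pickle_inv.
have GH k : G k `<=` HH k by rewrite /G /HH; case: choice.pickle_inv => // y w [].
have tHH : trivIset setT HH.
  move=> k l _ _ [w []]; rewrite /HH.
  have := choice.pickle_invK (T := seq nat) k.
  have := choice.pickle_invK (T := seq nat) l.
  case: choice.pickle_inv => // y; case: choice.pickle_inv => //= z.
  by move=> <- <- /HE -> /HE ->.
have tG : trivIset setT G.
  by move=> k l _ _ [w [/GH kw /GH lw]]; apply: tHH => //; exists w.
have PG k : (P (G k) <= (c%:R / n%:R)%:E * P (HH k))%E.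
  rewrite /G /HH; case: choice.pickle_inv => [y|]; last first.
    by rewrite measure0 mule0.
  rewrite PH muleC; apply: lee_wpmul2r => //; exact: uniform_prob_le.
exists (\bigcup_k G k); split.
- exact: bigcup_measurable.
- move=> w /= bw; exists (choice.pickle [seq X j w | j <- W]) => //.
  by rewrite /G choice.pickleK_inv; split.
rewrite measure_bigcup //.
apply: (@le_trans _ _ (\sum_(k <oo | k \in [set: nat]) (c%:R / n%:R)%:E * P (HH k))%E).
  by apply: lee_nneseries => // k _; exact: PG.
rewrite nneseriesZl // -measure_bigcup // -[leRHS]mule1.
apply: lee_wpmul2l; first by rewrite lee_fin divr_ge0.
by apply: probability_le1; exact: bigcup_measurable.
Qed.

End Independence.
End AlmostSure.

(** The successor includes the digit at [u] itself: this integer represents [xi] of any sequence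
    extending [u] modulo p^(2^(l+1)-1), where l is the length of [u]. *)
Definition prefix_sum (p : nat) (c : seq bool -> nat) (u : seq bool) : int :=
  xi_psum p (fun j => c (take j u)) (size u).+1.

Lemma prefix_sumE p c u : prefix_sum p c u =
  xi_psum p (fun j => c (take j u)) (size u) +
    (p ^ (2 ^ size u - 1) * c u)%N%:Z.
Proof. by rewrite /prefix_sum /xi_psum big_nat_recr //= take_size. Qed.

Lemma eq_xi_psum p c c' n : (forall j, (j < n)%N -> c j = c' j) ->
  xi_psum p c n = xi_psum p c' n.
Proof. by move=> cc; apply: eq_big_nat => j /andP[_ /cc ->]. Qed.

Lemma eq_prefix_sum p c c' u :
  (forall j, (j <= size u)%N -> c (take j u) = c' (take j u)) ->
  prefix_sum p c u = prefix_sum p c' u.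
Proof. by move=> cc; apply: eq_xi_psum => j /cc. Qed.

Lemma take_mkseq (X : Type) (f : nat -> X) j k : (j <= k)%N ->
  take j (mkseq f k) = mkseq f j.
Proof. by move=> jk; rewrite /mkseq -map_take take_iota (minn_idPl jk). Qed.

Lemma prefix_sum_mkseq p c (f : nat -> bool) k :
  prefix_sum p c (mkseq f k) = xi_psum p (fun j => c (mkseq f j)) k.+1.
Proof.
rewrite /prefix_sum size_mkseq; apply: eq_xi_psum => j jk.
by rewrite take_mkseq.
Qed.

Definition words k : seq (seq bool) :=
  flatten [seq [seq val t | t <- enum {: j.-tuple bool}] | j <- iota 0 k.+1].

Lemma mem_words k u : (size u <= k)%N -> u \in words k.
Proof.
move=> uk; apply/flatten_mapP; exists (size u); first by rewrite mem_iota.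
by apply/mapP; exists (in_tuple u); rewrite ?mem_enum.
Qed.

Section Extensions.
Variables k0 k : nat.

(** Finite functions between tuples make the assignments of continuations a finite type, as the
    union bound requires. Words of length other than [k0] go to the empty word. *)
Definition ext_fun (t : {ffun k0.-tuple bool -> k.-tuple bool}) (s : seq bool) :
    seq bool := oapp (fun s' => tval (t s')) [::] (insub s).

Lemma size_ext_fun t s : size s = k0 -> size (ext_fun t s) = k.
Proof.
by move=> sk; rewrite /ext_fun insubT ?sk // => ?; rewrite /= size_tuple.
Qed.

End Extensions.

(** * Approximate roots at one level and the union bound *)

Section KeyEstimate.
Context {d : measure_display} {T : measurableType d} {F : realType}.
Variables (P : probability T F) (p : nat) (V : zmodType).
Variable a : seq bool -> T -> nat.
Hypotheses (p_pr : prime p) (tfV : torsion_free V).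
Hypothesis a_rv : forall s, discrete_rv (a s).
Hypothesis a_unif : forall s,
  uniform_below P (p ^ (2 ^ (size s).+1 - 2 ^ size s))%N (a s).
Hypothesis a_ind : independent_rvs P a.

Variables (k0 N : nat) (S Q : seq (V * seq (seq bool))) (s0 : seq bool).
Hypotheses (s0k : size s0 = k0)
  (Svars : forall v, v \in pvars S -> size v = k0 /\ v != s0)
  (Qvars : forall v, v \in pvars Q -> size v = k0 /\ v != s0).

(** Variables are named by words of length [k0], and [t] continues them to length [k]. The exponent
    2^(k+1)-1 is the precision given by the digits up to level [k]. *)
Definition near_root k (t : seq bool -> seq bool) (c : seq bool -> nat) : Prop :=
  ~ pmultiples p N (poly_int (prefix_sum p c \o t) S) /\
  pmultiples p (2 ^ k.+1 - 1)
    (poly_int (prefix_sum p c \o t) S *~ prefix_sum p c (t s0) +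
     poly_int (prefix_sum p c \o t) Q).

Lemma eq_near_root k t c c' :
  (forall s, size s = k0 -> size (t s) = k) ->
  (forall v, (size v <= k)%N -> c v = c' v) ->
  near_root k t c -> near_root k t c'.
Proof.
move=> tk cc.
have E s : size s = k0 -> prefix_sum p c (t s) = prefix_sum p c' (t s).
  move=> sk; apply: eq_prefix_sum => j _; apply: cc.
  by rewrite -(tk _ sk) size_take_min geq_minr.
have ES : poly_int (prefix_sum p c \o t) S = poly_int (prefix_sum p c' \o t) S.
  by apply: eq_poly_int => v /Svars[vk _] /=; exact: E.
have EQ : poly_int (prefix_sum p c \o t) Q = poly_int (prefix_sum p c' \o t) Q.
  by apply: eq_poly_int => v /Qvars[vk _] /=; exact: E.
by rewrite /near_root ES EQ E.
Qed.

(** All digits at words of length at most [k] are held fixed except the one at [u0]. It influences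
    neither [S] nor [Q], only the last term of the root, and [card_solutions] bounds its bad
    values. *)
Lemma near_root_prob k t : (N <= 2 ^ k)%N -> (k0 <= k)%N ->
  (forall s, size s = k0 -> size (t s) = k /\ take k0 (t s) = s) ->
  exists E, [/\ measurable E, [set w | near_root k t (a^~ w)] `<=` E &
    (P E <= ((p ^ N)%:R / (p ^ 2 ^ k)%:R)%:E)%E].
Proof.
move=> Nk k0k tP; have [u0k u0s] := tP _ s0k; set u0 := t s0 in u0k u0s.
have pk : (2 ^ k.+1 - 2 ^ k = 2 ^ k)%N by rewrite expnS mul2n -addnn addnK.
pose W := [seq u <- undup (words k) | u != u0].
have uW : uniq (u0 :: W).
  by rewrite /= mem_filter eqxx filter_uniq // undup_uniq.
pose c y i v := if v == u0 then i else nth 0%N y (index v W).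
have au : uniform_below P (p ^ 2 ^ k)%N (a u0).
  by have := a_unif (s := u0); rewrite u0k pk; exact.
have n0 : (0 < p ^ 2 ^ k)%N by rewrite expn_gt0 prime_gt0.
have badP y : (#|[set i : 'I_(p ^ 2 ^ k) | `[< near_root k t (c y i) >]]%SET|
    <= p ^ N)%N.
  pose C := c y 0%N.
  have cE i v : v != u0 -> c y i v = C v by rewrite /C /c => /negbTE ->.
  have fE i s : size s = k0 -> s != s0 ->
      prefix_sum p (c y i) (t s) = prefix_sum p C (t s).
    move=> sk ss0; have [tk ts] := tP _ sk; apply: eq_prefix_sum => j jk.
    (* Equality with [u0] would force the length [k], hence j = k, and the same first [k0] letters,
       hence s = s0. *)
    apply: cE; apply/eqP => /(congr1 (fun u => (size u, take k0 u))) [].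
    rewrite size_take_min tk u0k => jE; have {}jE : j = k by move: jk; lia.
    rewrite jE -{1}tk take_size ts u0s => E.
    by rewrite E eqxx in ss0.
  have SE i : poly_int (prefix_sum p (c y i) \o t) S =
      poly_int (prefix_sum p C \o t) S.
    by apply: eq_poly_int => v /Svars[vk vs0] /=; exact: fE.
  have QE i : poly_int (prefix_sum p (c y i) \o t) Q =
      poly_int (prefix_sum p C \o t) Q.
    by apply: eq_poly_int => v /Qvars[vk vs0] /=; exact: fE.
  have uE i : prefix_sum p (c y i) u0 =
      xi_psum p (fun j => C (take j u0)) k + (p ^ (2 ^ k - 1) * i)%N%:Z.
    rewrite prefix_sumE u0k; congr (_ + _); last by rewrite /c eqxx.
    apply: eq_xi_psum => j jk; apply: cE; apply/eqP => /(congr1 size).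
    by rewrite size_take_min u0k; lia.
  have [Sn|Sn] := pselect (pmultiples p N (poly_int (prefix_sum p C \o t) S)).
    rewrite (_ : [set _ | _]%SET = finset.set0) ?cards0 //.
    apply/setP => i; rewrite !inE; apply/negbTE/asboolPn => -[].
    by rewrite SE.
  (* The digit has weight p^(2^k-1) and 2^k places, and (2^k-1) + 2^k = 2^(k+1)-1 is the required
     precision. *)
  apply: leq_trans (card_solutions p_pr tfV (2 ^ k - 1)
    (poly_int (prefix_sum p C \o t) Q)
    (xi_psum p (fun j => C (take j u0)) k) Nk Sn).
  apply/subset_leq_card/fintype.subsetP => i; rewrite !inE => -[_].
  rewrite SE QE uE; congr (pmultiples _ _ _).
  by rewrite expnS; have := expn_gt0 2 k; lia.
have [E [mE sE PE]] := independent_bad_le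
  (bad := fun y i => near_root k t (c y i)) a_rv a_ind n0 uW au badP.
exists E; split => // w nw; apply: sE => /=.
apply: eq_near_root nw => [s /tP[]//|v vk].
rewrite /c; case: eqP => [->//|/eqP vu].
have vW : v \in W by rewrite mem_filter vu mem_undup mem_words.
by rewrite (nth_map v) ?index_mem // nth_index.
Qed.

Definition psum (w : T) (f : nat -> bool) (n : nat) : int :=
  xi_psum p (fun j => a (mkseq f j) w) n.

(** The sequences [g s] are quantified inside the event, so one null set covers the uncountably many
    continuations of the given words. *)
Definition root_event : set T := [set w |
  exists g : seq bool -> nat -> bool,
    (forall s, size s = k0 -> mkseq (g s) k0 = s) /\
    forall k, (k0 <= k)%N -> (N <= 2 ^ k)%N ->
      ~ pmultiples p N (poly_int (fun s => psum w (g s) k.+1) S) /\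
      pmultiples p (2 ^ k.+1 - 1)
        (poly_int (fun s => psum w (g s) k.+1) S *~ psum w (g s0) k.+1 +
         poly_int (fun s => psum w (g s) k.+1) Q)].

Lemma prob_bigsetU_le (J : finType) (E : J -> set T) (x : F) :
  (forall j, measurable (E j)) -> (forall j, P (E j) <= x%:E)%E ->
  (P (\big[setU/set0]_(j : J) E j) <= (#|J|%:R * x)%:E)%E.
Proof.
move=> mE PE; rewrite cardT enumT [index_enum _]unlock; elim: (Finite.enum J) => [|j s IH].
  by rewrite big_nil measure0 mul0r.
rewrite big_cons; apply: (@le_trans _ _
    (P (E j) + P (\big[setU/set0]_(i <- s) E i))%E).
  by apply: measureU2 => //; exact: bigsetU_measurable.
by rewrite /= mulrS mulrDl mul1r EFinD; exact: leeD.
Qed.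

Lemma exists_level m c n : exists k, (n <= k)%N /\ (k * m + c <= 2 ^ k)%N.
Proof.
(* 2^(2l) is the square of 2^l > l, and l^2 = l(2m+c+n) is at least 2lm + c. *)
pose l := (2 * m + c + n)%N; exists (2 * l)%N; split; first by rewrite /l; lia.
rewrite mulnC expnM -[(2 ^ 2)%N]/(2 * 2)%N expnMn.
by have := ltn_expl l (ltnSn 1); rewrite /l; nia.
Qed.

Lemma near_root_negligible : P.-negligible root_event.
Proof.
apply: negligible_le_pow2 => j.
(* 2^k0 is the number of words to be continued; the slack [j] in k 2^k0 + N + j <= 2^k yields the
   factor 2^(-j). *)
have [k [k0k kj]] := exists_level (2 ^ k0) (N + j) k0.
have Nk : (N <= 2 ^ k)%N by lia.
pose J := {ffun k0.-tuple bool -> k.-tuple bool}.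
(* Tuples in the range of [t] need not extend their arguments; for such [t] the empty event serves
   below. *)
pose good (t : J) := `[< forall s, size s = k0 -> take k0 (ext_fun t s) = s >].
have p0 n : (0 < (p ^ n)%:R :> F) by rewrite ltr0n expn_gt0 prime_gt0.
have /choice[E EP] (t : J) : exists E, [/\ measurable E,
    (good t -> [set w | near_root k (ext_fun t) (a^~ w)] `<=` E) &
    (P E <= ((p ^ N)%:R / (p ^ 2 ^ k)%:R)%:E)%E].
  have [gt|ngt] := boolP (good t).
    have [|E [mE sE PE]] := near_root_prob (t := ext_fun t) Nk k0k.
      by move=> s sk; split; [exact: size_ext_fun|move/asboolP: gt; exact].
    by exists E.
  by exists set0; rewrite measure0 lee_fin divr_ge0.
exists (\big[setU/set0]_(t : J) E t); split.
- by apply: bigsetU_measurable => t _; have [] := EP t.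
- move=> w [g [gP /(_ k k0k Nk) [Sg Qg]]].
  have gk s : size (mkseq (g s) k) == k by rewrite size_mkseq.
  pose t : J := [ffun s : k0.-tuple bool => Tuple (gk s)].
  have tE s : size s = k0 -> ext_fun t s = mkseq (g s) k.
    by move=> sk; rewrite /ext_fun insubT ?sk // => ?; rewrite /= ffunE.
  have pE s : size s = k0 ->
      prefix_sum p (a^~ w) (ext_fun t s) = psum w (g s) k.+1.
    by move=> sk; rewrite tE // prefix_sum_mkseq.
  have gt : good t.
    by apply/asboolP => s sk; rewrite tE // take_mkseq // gP.
  rewrite -bigcup_seq; have [_ /(_ gt) h _] := EP t.
  exists t => /=; [exact: mem_index_enum|apply: h => /=].
  rewrite /near_root pE // (eq_poly_int (y := fun s => psum w (g s) k.+1)); last first.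
    by move=> v /Svars[vk _] /=; rewrite pE.
  rewrite (eq_poly_int (y := fun s => psum w (g s) k.+1)) //.
  by move=> v /Qvars[vk _] /=; rewrite pE.
apply: (le_trans (prob_bigsetU_le (x := (p ^ N)%:R / (p ^ 2 ^ k)%:R) _ _)).
- by move=> t; have [] := EP t.
- by move=> t; have [] := EP t.
rewrite lee_fin mulrA ler_pdivrMr // ler_pdivlMl ?exprn_gt0 //.
rewrite -natrX -!natrM ler_nat card_ffun !card_tuple card_bool -expnM.
(* Powers of 2 are bounded by powers of p, so that only exponents remain to be compared. *)
apply: (@leq_trans (p ^ j * (p ^ (k * 2 ^ k0) * p ^ N))).
  have e2 e : (2 ^ e <= p ^ e)%N by case: e => // e; rewrite leq_exp2r // prime_gt1.
  by rewrite !leq_mul.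
by rewrite -!expnD leq_exp2l ?prime_gt1 //; lia.
Qed.

End KeyEstimate.

(** * Almost sure independence of the p-adic integers *)

(** All terms from index [m] on carry the factor p^(2^m-1), the full precision used in the level
    estimate. *)
Lemma xi_psum_tail p c m i : (m <= i)%N ->
  pmultiples p (2 ^ m - 1) (xi_psum p c i - xi_psum p c m).
Proof.
move=> mi; rewrite /xi_psum (big_cat_nat (leq0n m) mi) //= addrAC subrr add0r.
rewrite big_nat; apply: (big_ind (pmultiples p (2 ^ m - 1))).
- exact: pmultiples0.
- exact: pmultiplesD.
move=> k /andP[mk _].
have mk2 : (2 ^ m - 1 <= 2 ^ k - 1)%N by rewrite leq_sub2r // leq_exp2l.
exists (p ^ (2 ^ k - 1 - (2 ^ m - 1)) * c k)%N%:Z => //.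
by rewrite -mulr_natr -natz -natrM natz mulnAC -expnD subnK.
Qed.

Section PolynomialsXi.
Variables (p : nat) (V : zmodType) (X : eqType).
Implicit Types (L : seq (V * seq X)).

Lemma poly_int_congr M (x y : X -> int) L :
  (forall v, pmultiples p M (x v - y v)) ->
  pmultiples p M (poly_int x L - poly_int y L).
Proof.
move=> xy; rewrite /poly_int -sumrB; apply: pmultiples_sum => m.
rewrite /mono_int; elim: m.2 => [|v s [u _ uE]] /=.
  by rewrite subrr; exact: pmultiples0.
have [w _ wE] := xy v.
exists (u *~ x v + foldr (fun v b => b *~ y v) m.1 s *~ w) => //.
exact: mulrzB_pmul.
Qed.

Lemma poly_int_psum_congr (c : X -> nat -> nat) L m i : (m <= i)%N ->
  pmultiples p (2 ^ m - 1) (poly_int (fun v => xi_psum p (c v) i) L -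
                            poly_int (fun v => xi_psum p (c v) m) L).
Proof. by move=> mi; apply: poly_int_congr => v; exact: xi_psum_tail. Qed.

(** The first [k] terms determine the value modulo p^(2^k-1), so each precision can be tested at a
    definite partial sum instead of at all late ones. *)
Lemma poly_xi_eq0 (c : X -> nat -> nat) L :
  poly_padic (fun v => xi p (c v)) L = 0 <->
  forall k, pmultiples p (2 ^ k - 1) (poly_int (fun v => xi_psum p (c v) k) L).
Proof.
have [u /= uE ui] := poly_padicE (fun v => PCauchy (xi_subproof p (c v))) L.
rewrite [X in X = 0](uE : _ = _) pclass_eq0; split=> h.
  move=> k; have [N uN] := h (2 ^ k - 1)%N.
  apply: pmultiples_congr (uN (maxn N k) (leq_maxl _ _)).
  by rewrite ui /=; apply: poly_int_psum_congr; rewrite leq_maxr.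
move=> m; exists m => i mi; rewrite ui /=; apply: pmultiples_le (h i).
by have := ltn_expl i (ltnSn 1); lia.
Qed.

Definition mulX (v : X) L := [seq (m.1, v :: m.2) | m <- L].

Lemma poly_int_mulX (x : X -> int) v L Q :
  poly_int x (mulX v L ++ Q) = poly_int x L *~ x v + poly_int x Q.
Proof.
rewrite /poly_int big_cat big_map; congr (_ + _).
by elim: L => [|m L IH]; rewrite ?big_nil ?mul0rz // !big_cons mulrzDl IH.
Qed.

Lemma poly_padic_mulX (x : X -> Jp p) v L Q :
  poly_padic x (mulX v L ++ Q) = pscale (x v) (poly_padic x L) + poly_padic x Q.
Proof.
by rewrite /poly_padic big_cat big_map raddf_sum.
Qed.

End PolynomialsXi.

(** [k] exceeds, for every two distinct sequences in [L], some index at which they differ. *)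
Lemma mkseq_separates (L : seq (nat -> bool)) : exists k,
  {in L &, injective (fun v : nat -> bool => mkseq v k)}.
Proof.
have /choice[D DP] (uv : (nat -> bool) * (nat -> bool)) :
    exists i, uv.1 i = uv.2 i -> uv.1 = uv.2.
  have [//|ne] := pselect (uv.1 = uv.2); first by exists 0%N.
  have [i ni] : exists i, uv.1 i <> uv.2 i.
    by apply/existsNP => h; apply: ne; apply/funext.
  by exists i.
exists (\max_(u <- L) \max_(v <- L) (D (u, v)).+1)%N => u v uL vL uv.
apply: (DP (u, v)) => /=.
have lt : (D (u, v) < \max_(u <- L) \max_(v <- L) (D (u, v)).+1)%N.
  pose M u := (\max_(v <- L) (D (u, v)).+1)%N.
  have h1 := leq_bigmax_seq (P := xpredT) (F := fun v => (D (u, v)).+1) v vL isT.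
  have h2 := leq_bigmax_seq (P := xpredT) (F := M) u uL isT.
  exact: leq_trans h1 h2.
by have := congr1 (fun s => nth false s (D (u, v))) uv; rewrite /= !nth_mkseq.
Qed.

Section Independence.
Context {d : measure_display} {T : measurableType d} {F : realType}.
Variables (P : probability T F) (p : nat) (V : zmodType).
Variable a : seq bool -> T -> nat.
Hypotheses (p_pr : prime p) (tfV : torsion_free V).
Hypothesis V_count : countable [set: V].
Hypothesis a_rv : forall s, discrete_rv (a s).
Hypothesis a_unif : forall s,
  uniform_below P (p ^ (2 ^ (size s).+1 - 2 ^ size s))%N (a s).
Hypothesis a_ind : independent_rvs P a.

Definition xi_at (w : T) (v : nat -> bool) : Jp p :=
  xi p (fun k => a (mkseq v k) w).

(** Counterexamples form an uncountable family. Cutting their variables to initial segments that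
    still separate them leaves countably many codes, and [root_event] accounts for all
    continuations. *)
Lemma xi_independent : {ae P, forall w,
  forall (S Q : seq (V * seq (nat -> bool))) v0,
    v0 \notin pvars S -> v0 \notin pvars Q ->
    pscale (xi_at w v0) (poly_padic (xi_at w) S) + poly_padic (xi_at w) Q = 0 ->
    poly_padic (xi_at w) S = 0}.
Proof.
have [h [e eK]] := countable_enum 0 V_count.
pose dec (L : seq (nat * seq (seq bool))) : seq (V * seq (seq bool)) :=
  [seq (e m.1, m.2) | m <- L].
pose enc (L : seq (V * seq (seq bool))) := [seq (h m.1, m.2) | m <- L].
have encK : cancel enc dec.
  by move=> L; rewrite /dec /enc -map_comp map_id_in // => -[b s] _ /=; rewrite eK.
pose code : Type := (nat * nat * seq (nat * seq (seq bool)) *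
  seq (nat * seq (seq bool)) * seq bool)%type.
pose ok k0 s0 (L : seq (V * seq (seq bool))) :=
  forall v, v \in pvars L -> size v = k0 /\ v != s0.
pose bad (x : code) : set T := let: (k0, N, LS, LQ, s0) := x in
  [set w | [/\ size s0 = k0, ok k0 s0 (dec LS), ok k0 s0 (dec LQ) &
    root_event p a k0 N (dec LS) (dec LQ) s0 w]].
have bad0 x : P.-negligible (bad x).
  case: x => -[[[k0 N] S] Q] s0 /=.
  have [[s0k okS okQ]|nok] :=
      pselect [/\ size s0 = k0, ok k0 s0 (dec S) & ok k0 s0 (dec Q)].
    apply: negligibleS (near_root_negligible p_pr tfV a_rv a_unif a_ind N s0k okS okQ).
    by move=> w [].
  apply: negligibleS (negligible_set0 P) => w [s0k okS okQ _].
  by apply: nok.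
have cc : countable [set: code] by exact: countableP.
apply: negligibleS (negligible_countable_bigcup cc bad0).
move=> w /= /existsNP[S /existsNP[Q /existsNP[v0 /not_implyP[v0S]]]].
move=> /not_implyP[v0Q /not_implyP[]].
rewrite -poly_padic_mulX => /poly_xi_eq0 R0 S0.
have [k1 Sk1] : exists k1, ~ pmultiples p (2 ^ k1 - 1)
    (poly_int (fun v => psum p a w v k1) S).
  by apply/existsNP => S0'; apply: S0; apply/poly_xi_eq0.
(* At level [k1] the value of [S] is visibly nonzero, which supplies the power p^N that does not
   divide it. *)
set N := (2 ^ k1 - 1)%N in Sk1.
have [k0 kI] := mkseq_separates (v0 :: pvars S ++ pvars Q).
set L := v0 :: _ in kI.
pose lab (v : nat -> bool) := mkseq v k0.
(* The variable in [L] with label [s]; a word that labels none is continued by [false]. *)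
pose g s := nth (nth false s) L (find (fun v => lab v == s) L).
have gK v : v \in L -> g (lab v) = v.
  move=> vL; have hv : has (fun u => lab u == lab v) L by apply/hasP; exists v.
  apply: kI => //; first by rewrite mem_nth // -has_find.
  by apply/eqP; exact: (nth_find _ hv).
have gP s : size s = k0 -> mkseq (g s) k0 = s.
  move=> sk; have [hs|hs] := boolP (has (fun v => lab v == s) L).
    by apply/eqP; exact: (nth_find _ hs).
  rewrite /g nth_default; last by rewrite leqNgt -has_find.
  by rewrite -{2}(mkseq_nth false s) sk.
pose rel (M : seq (V * seq (nat -> bool))) := [seq (m.1, map lab m.2) | m <- M].
have relE k M : {subset pvars M <= L} ->
    poly_int (fun s => psum p a w (g s) k) (rel M) =
    poly_int (fun v => psum p a w v k) M.
  move=> sM; rewrite poly_int_map; apply: eq_poly_int => v vM /=.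
  by rewrite gK // sM.
have SL : {subset pvars S <= L} by move=> v vS; rewrite inE mem_cat vS orbT.
have QL : {subset pvars Q <= L} by move=> v vS; rewrite inE mem_cat vS !orbT.
have v0L : v0 \in L by rewrite mem_head.
have okrel M : {subset pvars M <= L} -> v0 \notin pvars M -> ok k0 (lab v0) (rel M).
  move=> sM v0M v; rewrite pvars_map => /mapP[u uM ->].
  rewrite size_mkseq; split => //; apply/eqP => /kI uv; move: v0M.
  by rewrite -uv ?uM // sM.
exists (k0, N, enc (rel S), enc (rel Q), lab v0); rewrite /= !encK; split.
- by rewrite size_mkseq.
- exact: okrel.
- exact: okrel.
exists g; split => // k _ Nk; rewrite !relE // gK //; split; last first.
  by have := R0 k.+1; rewrite poly_int_mulX.
(* From 2^k1 - 1 <= 2^k follows k1 <= k+1, so the sums of k+1 terms and of k1 terms give [S] the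
   same value modulo p^N. *)
have k1k : (k1 <= k.+1)%N.
  rewrite leqNgt; apply/negP => lt.
  have : (2 ^ k.+2 <= 2 ^ k1)%N by rewrite leq_exp2l.
  by rewrite !expnS; move: Nk; rewrite /N; have := expn_gt0 2 k; lia.
move=> h'; apply: Sk1; apply: pmultiples_congr h'.
exact: poly_int_psum_congr.
Qed.

End Independence.

(** * Random finite sets containing a given pair infinitely often *)

Lemma ae_forall_countable {d : measure_display} {T : measurableType d}
    {F : realType} (P : probability T F) (X : Type) (Q : X -> T -> Prop) :
  countable [set: X] -> (forall x, {ae P, forall w, Q x w}) ->
  {ae P, forall w, forall x, Q x w}.
Proof.
move=> cX Qx; apply: negligibleS (negligible_countable_bigcup cX Qx).
by move=> w /= /existsNP.
Qed.

Section CofinallyContained.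
Context {d : measure_display} {T : measurableType d} {F : realType}.
Variables (P : probability T F) (B : choiceType) (I : nat -> T -> {fset B}).
Hypotheses (B_count : countable [set: B]) (I_rv : forall n, discrete_rv (I n)).
Hypotheses (I_ind : independent_rvs P I) (I_id : identically_distributed P I).
Hypothesis I_pos : forall n (E : {fset B}), E != fset0 ->
  (0 < P [set w | (E `<=` I n w)%fset])%E.

(** The probability [q] that [I n] does not contain both elements is the same for all [n] and less
    than 1. By independence, failure at all indices from [m] on has probability at most q^N for
    every [N], hence 0. *)
Lemma cofinally_contained : {ae P, forall w, forall b c m,
  exists n, [/\ (m <= n)%N, b \in I n w & c \in I n w]}.
Proof.
apply: ae_forall_countable => // b; apply: ae_forall_countable => // c.
apply: ae_forall_countable => // m.
pose E : {fset B} := [fset b; c]%fset.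
have E0 : E != fset0 by apply/fset0Pn; exists b; rewrite !inE eqxx.
pose C : set {fset B} := [set A | ~ (E `<=` A)%fset].
pose Z n := I n @^-1` C.
have mZ n : measurable (Z n) by exact: I_rv.
pose q := fine (P (Z 0%N)).
have PZ n : P (Z n) = q%:E by rewrite fineK ?fin_num_measure //; exact: I_id.
have q0 : 0 <= q by rewrite fine_ge0.
have q1 : q < 1.
  have mG : measurable (I 0%N @^-1` [set A | (E `<=` A)%fset]) by exact: I_rv.
  have ZE : Z 0%N = ~` (I 0%N @^-1` [set A | (E `<=` A)%fset]) by [].
  have := I_pos 0 E0; rewrite -lte_fin -(PZ 0%N) ZE probability_setC //.
  have -> : [set w | (E `<=` I 0%N w)%fset] = I 0%N @^-1` [set A | (E `<=` A)%fset] by [].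
  rewrite -[P _]fineK ?fin_num_measure // -EFinB !lte_fin.
  by rewrite ltrBlDr ltrDl.
pose A := \bigcap_n Z (m + n)%N.
have mA : measurable A by apply: bigcap_measurable => // n _; exact: mZ.
have PA N : (P A <= (q ^+ N)%:E)%E.
  have uN : uniq (iota m N) by exact: iota_uniq.
  have := I_ind (fun=> C) uN.
  rewrite (eq_bigr (fun=> q%:E)); last by move=> n _; exact: PZ.
  have -> : (\prod_(j <- iota m N) q%:E)%E = (q ^+ N)%:E.
    by rewrite prodEFin big_const_seq count_predT size_iota -Monoid.iteropE.
  move=> <-; apply: le_measure; rewrite ?inE //.
    apply: fin_bigcap_measurable => [|n _]; [exact: finite_seq|exact: mZ].
  move=> w Aw n /=; rewrite mem_iota => /andP[mn _].
  by have := Aw (n - m)%N Logic.I; rewrite /= subnKC.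
exists A; split => //; last first.
  move=> w /= /forallNP nw n _ /= h; apply: (nw (m + n)%N).
  have /fsubsetP EI := h; split; first exact: leq_addr.
    by apply: EI; rewrite !inE eqxx.
  by apply: EI; rewrite !inE eqxx orbT.
apply/eqP; rewrite eq_le measure_ge0 andbT.
rewrite -[P A]fineK ?fin_num_measure // lee_fin.
have qc : (fun N => q ^+ N) @ \oo --> (0 : F) by apply: cvg_expr; rewrite ger0_norm.
rewrite -(cvg_lim _ qc) //; apply: limr_ge; first by apply/cvg_ex; exists 0.
by apply: nearW => N; rewrite -lee_fin fineK ?fin_num_measure.
Qed.

End CofinallyContained.

(** * Free modules *)

(** Extension by zero lets sums with different supports be compared over a common one. *)
Lemma big_uniq_sub (V : zmodType) (X : eqType) (s u : seq X) (G : X -> V) :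
  uniq s -> uniq u -> {subset s <= u} ->
  \sum_(e <- s) G e = \sum_(e <- u) (if e \in s then G e else 0).
Proof.
move=> us uu su; rewrite -big_mkcond -big_filter; apply: perm_big.
apply: uniq_perm; rewrite ?filter_uniq // => e.
by rewrite mem_filter; case: (boolP (e \in s)) => // /su ->.
Qed.

Section FreeModuleTheory.
Variables (R : pzRingType) (B : lmodType R).
Implicit Types (E : set B) (s : seq B).

(** Repeated generators are merged by multiplying the coefficient with the multiplicity. *)
Lemma generates_uniq E x : generates E -> exists s (c : B -> R),
  [/\ uniq s, forall e, e \in s -> E e & x = \sum_(e <- s) c e *: e].
Proof.
move=> /(_ x)[s [c [sE ->]]]; exists (undup s), (fun e => c e *+ count_mem e s).
split; [exact: undup_uniq|by move=> e; rewrite mem_undup; exact: sE|].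
rewrite -big_undup_iterop_count; apply: eq_bigr => e _.
by rewrite -scalerMnl.
Qed.

Lemma generates_sub E x s : generates E -> uniq s -> (forall e, e \in s -> E e) ->
  exists u (c : B -> R), [/\ uniq u, forall e, e \in u -> E e, {subset s <= u} &
    x = \sum_(e <- u) c e *: e].
Proof.
move=> gE us sE; have [s' [c [us' s'E ->]]] := generates_uniq x gE.
exists (undup (s ++ s')), (fun e => if e \in s' then c e else 0); split.
- exact: undup_uniq.
- by move=> e; rewrite mem_undup mem_cat => /orP[/sE|/s'E].
- by move=> e es; rewrite mem_undup mem_cat es.
rewrite (big_uniq_sub _ us' (undup_uniq (s ++ s'))).
  by apply: eq_bigr => e _; case: ifP => // _; rewrite scale0r.
by move=> e es; rewrite mem_undup mem_cat es orbT.
Qed.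

Lemma lin_independent_eq E s (c c' : B -> R) : lin_independent E -> uniq s ->
  (forall e, e \in s -> E e) ->
  \sum_(e <- s) c e *: e = \sum_(e <- s) c' e *: e -> {in s, c =1 c'}.
Proof.
move=> lE us sE /eqP; rewrite -subr_eq0 -sumrB => /eqP cc e es.
apply/eqP; rewrite -subr_eq0; apply/eqP.
apply: (lE s (fun e => c e - c' e)) => //.
by rewrite -[RHS]cc; apply: eq_bigr => b _; rewrite scalerBl.
Qed.

Lemma sum_scaleMn s (c : B -> R) n :
  (\sum_(e <- s) c e *: e) *+ n = \sum_(e <- s) (c e *+ n) *: e.
Proof. by rewrite -sumrMnl; apply: eq_bigr => e _; rewrite scalerMnl. Qed.

Lemma free_torsion_free : torsion_free R -> free_module B -> torsion_free B.
Proof.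
move=> tfR [E [lE gE]] x n n0; have [s [c [us sE ->]]] := generates_uniq x gE.
rewrite sum_scaleMn => c0; rewrite big_seq big1 // => e es.
by rewrite (tfR (c e) n n0) ?scale0r // (lE _ _ us sE c0 e es).
Qed.

(** Comparing coordinates over a common support shows that each coefficient of [x] is divisible by
    every p^n in [R]. *)
Lemma free_p_reduced p : p_reduced p R -> free_module B -> p_reduced p B.
Proof.
move=> rR [E [lE gE]]; apply/seteqP; split=> [x xp|_ -> n _]; last first.
  exact: pmultiples0.
have [s [c [us sE xE]]] := generates_uniq x gE.
rewrite /= xE big_seq big1 // => e es; suff -> : c e = 0 by rewrite scale0r.
suff : [set 0] (c e) by [].
rewrite -rR => n _; have [y _ yx] := xp n Logic.I.
have [u [d [uu uE su yE]]] := generates_sub y gE us sE.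
exists (d e) => //; move: yx.
rewrite xE yE sum_scaleMn (big_uniq_sub _ us uu su).
rewrite [RHS](eq_bigr (fun e => (if e \in s then c e else 0) *: e)).
  by move=> /(lin_independent_eq lE uu uE)/(_ e (su _ es)) ->; rewrite es.
by move=> b _; case: ifP => // _; rewrite scale0r.
Qed.

(** [e] is a basis element. Its multiples determine their scalars, and an integer dividing a
    multiple of [e] divides the scalar in [R]; this recovers the scalar of a homomorphism. *)
Lemma free_basis_vector : free_module B -> (exists b : B, b != 0) ->
  exists e : B, (forall r : R, r *: e = 0 -> r = 0) /\
    (forall (x : B) n (r : R), x *+ n = r *: e -> exists r', r = r' *+ n).
Proof.
move=> [E [lE gE]] [b b0]; have [s [c [us sE bE]]] := generates_uniq b gE.
case: s us sE bE => [|e s] _ sE bE; first by rewrite bE big_nil eqxx in b0.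
have Ee : E e by apply: sE; rewrite mem_head.
have eE e' : e' \in [:: e] -> E e' by rewrite inE => /eqP ->.
exists e; split=> [r re|x n r].
  by apply: (lE [:: e] (fun=> r) isT eE _ e); rewrite ?big_seq1 ?mem_head.
have [u [d [uu uE su ->]]] := generates_sub (s := [:: e]) x gE isT eE.
have eu : e \in u by apply: su; rewrite mem_head.
rewrite sum_scaleMn => h; exists (d e).
have -> : r = if e \in [:: e] then r else 0 by rewrite mem_head.
apply/esym/(lin_independent_eq (c := fun e => d e *+ n)
  (c' := fun x => if x \in [:: e] then r else 0) lE uu uE _ eu).
rewrite h; have := big_uniq_sub (fun e => r *: e) (isT : uniq [:: e]) uu su.
rewrite big_seq1 => ->; apply: eq_bigr => b' _.
by case: ifP => // _; rewrite scale0r.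
Qed.

Lemma countably_generated_countable :
  countable [set: R] -> countably_generated B -> countable [set: B].
Proof.
move=> /(countable_enum 0)[h [r rK]] [E [/(countable_enum 0)[k [v vK]] gE]].
pose D (l : seq (nat * nat)) : B := \sum_(m <- l) r m.1 *: v m.2.
apply: (@sub_countable _ _ _ (range D)); last first.
  by apply: sub_countable (card_image_le _ _) _; exact: countableP.
apply: subset_card_le => x _; have [s [c [sE ->]]] := gE x.
exists [seq (h (c e), k e) | e <- s] => //.
rewrite /D big_map; apply: eq_big_seq => e es /=.
by rewrite rK // vK //; exact: sE.
Qed.

End FreeModuleTheory.

(** * Homomorphisms of the groups G^A *)

Section PureSpan.
Variables (p : nat) (V : zmodType) (S : set V).

Lemma subgroup_smallest : is_subgroup (smallest (@is_subgroup V) S).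
Proof.
split=> [X [[]]//|x y Sx Sy X XP].
by apply: XP.1.2; [exact: Sx|exact: Sy].
Qed.

Lemma mem_pure_span x : S x -> x \in pure_span p S.
Proof.
move=> Sx; apply/asboolP; exists 0%N; rewrite mulr1n => X [_]; exact.
Qed.

Lemma pure_span_pure x k : x *+ p ^ k \in pure_span p S -> x \in pure_span p S.
Proof.
by move=> /asboolP[l xl]; apply/asboolP; exists (k + l)%N; rewrite expnD mulrnA.
Qed.

Lemma pgval_inj : injective (@pgval p V S).
Proof. exact: val_inj. Qed.

Lemma pgval_mem (x : pure_group p S) : pgval x \in pure_span p S.
Proof. exact: valP. Qed.

Lemma pgval_zmod_morphism : zmod_morphism (@pgval p V S).
Proof. exact: (raddfB val). Qed.

HB.instance Definition _ := GRing.isZmodMorphism.Build (pure_group p S) V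
  (@pgval p V S) pgval_zmod_morphism.

End PureSpan.

Section Generators.
Variables (p : nat) (R : pzRingType) (B : lmodType R) (K : choiceType).
Variable a : nat -> K -> pcompl p B.
Implicit Types (A D : set K) (s : seq (nat * K)) (u v : pcompl p B).

(** The support [s] is a parameter so that several elements can be written over one common list. *)
Definition rep s u := exists (b : B) (r : nat * K -> R),
  u = pembed p b + \sum_(j <- s) r j *: a j.1 j.2.

Lemma repB s u v : rep s u -> rep s v -> rep s (u - v).
Proof.
move=> [b [r ->]] [c [q ->]]; exists (b - c), (fun j => r j - q j).
rewrite raddfB opprD addrACA -sumrB; congr (_ + _).
by apply: eq_bigr => j _; rewrite scalerBl.
Qed.

Lemma repMn s u n : rep s u -> rep s (u *+ n).
Proof.
move=> [b [r ->]]; exists (b *+ n), (fun j => r j *+ n).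
rewrite mulrnDl raddfMn -sumrMnl; congr (_ + _).
by apply: eq_bigr => j _; rewrite scalerMnl.
Qed.

Lemma rep_sub s s' u : uniq s -> uniq s' -> {subset s <= s'} ->
  rep s u -> rep s' u.
Proof.
move=> us us' ss' [b [r ->]]; exists b, (fun j => if j \in s then r j else 0).
rewrite (big_uniq_sub _ us us' ss'); congr (_ + _).
by apply: eq_bigr => j _; case: ifP => // _; rewrite scale0r.
Qed.

Definition index_seq D s := uniq s /\ forall j, j \in s -> D j.2.

Lemma index_seq_undup D s s' :
  index_seq D s -> index_seq D s' -> index_seq D (undup (s ++ s')).
Proof.
move=> [us sD] [us' sD']; split; first exact: undup_uniq.
by move=> j; rewrite mem_undup mem_cat => /orP[/sD|/sD'].
Qed.

Lemma rep_catl D s s' u : index_seq D s -> rep s u -> rep (undup (s ++ s')) u.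
Proof.
move=> [us _]; apply: rep_sub => //; first exact: undup_uniq.
by move=> j js; rewrite mem_undup mem_cat js.
Qed.

Lemma rep_catr D s s' u : index_seq D s' -> rep s' u -> rep (undup (s ++ s')) u.
Proof.
move=> [us _]; apply: rep_sub => //; first exact: undup_uniq.
by move=> j js; rewrite mem_undup mem_cat js orbT.
Qed.

(** The elements with such a representation form a subgroup containing the generators. *)
Lemma pure_span_rep D u : u \in pure_span p (generatorsG a D) ->
  exists k s, index_seq D s /\ rep s (u *+ p ^ k).
Proof.
move=> /asboolP[k uk]; exists k.
apply: (uk [set v | exists s, index_seq D s /\ rep s v]); split.
  split=> [|x y [s [sD xs]] [s' [sD' ys']]].
    exists [::]; split; first by split.
    by exists 0, (fun=> 0); rewrite big_nil raddf0 addr0.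
  exists (undup (s ++ s')); split; first exact: index_seq_undup.
  by apply: repB; [exact: rep_catl sD xs|exact: rep_catr sD' ys'].
move=> x [[b _ <-]|[r [n [al [Dal ->]]]]].
  exists [::]; split; first by split.
  by exists b, (fun=> 0); rewrite big_nil addr0.
exists [:: (n, al)]; split; first by split=> // j; rewrite inE => /eqP ->.
by exists 0, (fun=> r); rewrite big_seq1 raddf0 add0r.
Qed.

Lemma pure_span_rep_seq D (l : seq (pcompl p B)) :
  (forall u, u \in l -> u \in pure_span p (generatorsG a D)) ->
  exists k s, index_seq D s /\ forall u, u \in l -> rep s (u *+ p ^ k).
Proof.
elim: l => [|u l IH] lP; first by exists 0%N, [::]; split.
have [k [s [sD us]]] := pure_span_rep (lP u (mem_head _ _)).
have [k' [s' [sD' ls']]] : exists k s, index_seq D s /\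
    forall u, u \in l -> rep s (u *+ p ^ k).
  by apply: IH => v vl; apply: lP; rewrite inE vl orbT.
exists (k + k')%N, (undup (s ++ s')); split; first exact: index_seq_undup.
move=> v; rewrite inE expnD => /orP[/eqP ->|vl].
  by rewrite mulrnA; apply/repMn/(rep_catl _ sD).
by rewrite mulnC mulrnA; apply/repMn/(rep_catr _ sD')/ls'.
Qed.

(** The preimage under multiplication by [r] of the subgroup generated for [D] is a subgroup
    containing the generators for [A]. *)
Lemma scale_pure_span A D (r : R) u : A `<=` D ->
  u \in pure_span p (generatorsG a A) ->
  r *: u \in pure_span p (generatorsG a D).
Proof.
move=> AD /asboolP[k uk]; apply/asboolP; exists k; rewrite /= scalerMnr.
have [g0 gB] := subgroup_smallest (generatorsG a D).
apply: (uk [set v | smallest (@is_subgroup _) (generatorsG a D) (r *: v)]); split.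
  split; first by rewrite /= scaler0.
  by move=> x y xD yD /=; rewrite scalerBr; exact: gB.
move=> x xA X [_ XD]; apply: XD; case: xA => [[b _ <-]|[q [n [al [Aal ->]]]]].
  by left; exists (r *: b) => //; rewrite -scale_pembed.
by right; exists (r * q), n, al; split; [exact: AD|rewrite scalerA].
Qed.

Section GroupElements.
Variable A : set K.

Lemma pembed_mem b : pembed p b \in pure_span p (generatorsG a A).
Proof. by apply: mem_pure_span; left; exists b. Qed.

Definition gembed b : groupG p a A := PureGroup (pembed_mem b).

Lemma generator_mem n al : A al -> a n al \in pure_span p (generatorsG a A).
Proof.
by move=> Aal; apply: mem_pure_span; right; exists 1, n, al; rewrite scale1r.
Qed.

Hypotheses (p_pr : prime p) (tfB : torsion_free B).

Lemma pure_group_div (x : groupG p a A) u m : pgval x = u *+ p ^ m ->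
  exists y, x = y *+ p ^ m.
Proof.
move=> xu; have uA : u \in pure_span p (generatorsG a A).
  by apply: (@pure_span_pure _ _ _ _ m); rewrite -xu pgval_mem.
by exists (PureGroup uA); apply: pgval_inj; rewrite raddfMn.
Qed.

(* [B] is [p]-dense in [G^A] and the completion is [p]-reduced. *)
Lemma eq0_on_dense (H : groupG p a A -> pcompl p B) :
  {morph H : x y / x - y} -> (forall b, H (gembed b) = 0) -> forall x, H x = 0.
Proof.
move=> HB HE x; apply: pcompl_reduced => m.
have [b [u _ uE]] := pembed_dense p_pr tfB (pgval x) m.
have [y yE] : exists y, x - gembed b = y *+ p ^ m.
  by apply: (@pure_group_div _ u); rewrite raddfB uE.
have H0 : H 0 = 0 by rewrite -(subrr 0) HB subrr.
have HM n z : H (z *+ n) = H z *+ n.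
  elim: n => [|n IH]; first by rewrite !mulr0n.
  rewrite !mulrSr -IH; apply/eqP; rewrite -subr_eq -HB addrK; exact/eqP.
exists (H y) => //; rewrite -HM -yE HB HE; exact: subr0.
Qed.

End GroupElements.
End Generators.

(** * Rigidity for a fixed outcome of the random choices *)

Section Rigidity.
Variables (p : nat) (R : pzRingType) (B : lmodType R) (K : choiceType).
Variables (I : nat -> {fset B}) (x_ : nat * B * K -> Jp p).
Hypotheses (p_pr : prime p) (tfB : torsion_free B) (rB : p_reduced p B).
Hypothesis x_ind : forall (S Q : seq (B * seq (nat * B * K))) v0,
  v0 \notin pvars S -> v0 \notin pvars Q ->
  pscale (x_ v0) (poly_padic x_ S) + poly_padic x_ Q = 0 ->
  poly_padic x_ S = 0.
Hypothesis I_cof : forall b c m, exists n, [/\ (m <= n)%N, b \in I n & c \in I n].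
Variable e1 : B.
Hypothesis e1_free : forall r : R, r *: e1 = 0 -> r = 0.
Hypothesis e1_div :
  forall (x : B) n (r : R), x *+ n = r *: e1 -> exists r', r = r' *+ n.

Let a n al : pcompl p B := \sum_(b <- I n) pscale (x_ (n, b, al)) (pembed p b).

Let expp_gt0 n : (0 < p ^ n)%N. Proof. by rewrite expn_gt0 prime_gt0. Qed.

Lemma pembed_eq0 (b : B) : pembed p b = 0 -> b = 0.
Proof. by rewrite -(raddf0 (@pembed p B)) => /(pembed_inj rB). Qed.

(** In a linear relation the slope of [x_ v] is the constant [c v], so [x_ind] applies to each [v]
    in turn. *)
Lemma linear_independence (s : seq (nat * B * K)) (c : nat * B * K -> B) b :
  uniq s -> \sum_(v <- s) pscale (x_ v) (pembed p (c v)) = pembed p b ->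
  (forall v, v \in s -> c v = 0) /\ b = 0.
Proof.
move=> us sb; have c0 v : v \in s -> c v = 0.
  move=> vs; apply: pembed_eq0.
  have SE : poly_padic x_ [:: (c v, [::])] = pembed p (c v).
    by rewrite /poly_padic big_seq1.
  rewrite -SE.
  apply: (x_ind (v0 := v)
    (Q := [seq (c u, [:: u]) | u <- rem v s] ++ [:: (- b, [::])])) => //.
    by rewrite pvars_cat pvars_linear map_id cats0 mem_rem_uniq // !inE eqxx.
  rewrite poly_padic_cat SE addrA.
  rewrite [X in _ + X](_ : _ = - pembed p b); last first.
    by rewrite /poly_padic big_seq1 /mono_padic /= raddfN.
  apply/eqP; rewrite subr_eq0 -sb; apply/eqP; rewrite (big_rem v) //=.
  by rewrite /poly_padic big_map.
split=> //; apply: pembed_eq0; rewrite -sb big_seq big1 // => v vs.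
by rewrite c0 // !raddf0.
Qed.

Let scale_a (r : R) n al :
  r *: a n al = \sum_(b <- I n) pscale (x_ (n, b, al)) (pembed p (r *: b)).
Proof.
rewrite /a scaler_sumr; apply: eq_bigr => b _.
by rewrite scale_pscale scale_pembed.
Qed.

Lemma scale_a_eq0 (r : R) n al : (forall c, c \in I n -> r *: c = 0) ->
  r *: a n al = 0.
Proof.
move=> r0; rewrite scale_a big_seq big1 // => c cI.
by rewrite r0 // !raddf0.
Qed.

Let row n al : seq (nat * B * K) := [seq (n, b, al) | b <- I n].

Let row_uniq n al : uniq (row n al).
Proof. by rewrite map_inj_uniq ?fset_uniq // => b c []. Qed.

Lemma row_independence n al (c : B -> B) b :
  \sum_(e <- I n) pscale (x_ (n, e, al)) (pembed p (c e)) = pembed p b ->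
  (forall e, e \in I n -> c e = 0) /\ b = 0.
Proof.
move=> h; have [|c0 b0] := @linear_independence (row n al)
    (fun v => c v.1.2) b (row_uniq n al).
  by rewrite big_map.
split=> // e eI; apply: (c0 (n, e, al)).
by apply/mapP; exists e.
Qed.

(* The hypotheses say that two elements of [G^D] satisfy a relation that is
   polynomial in the [x_]. Every [x_ (j, c)] with [j <> (n, al)] occurs in it
   with a slope linear in the [x_ (n, e, al)]: [x_ind] makes that slope vanish,
   and then [row_independence] makes the coefficients of the slope vanish. *)
Lemma generator_relation (D : set K) n al (g : B -> pcompl p B) y :
  (forall e, g e \in pure_span p (generatorsG a D)) ->
  y \in pure_span p (generatorsG a D) ->
  y = \sum_(e <- I n) pscale (x_ (n, e, al)) (g e) ->
  exists k (b : B -> B) (r : B -> R) b' r', [/\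
    forall e, e \in I n -> g e *+ p ^ k = pembed p (b e) + r e *: a n al,
    y *+ p ^ k = pembed p b' + r' *: a n al &
    D al \/ r' = 0].
Proof.
move=> gD yD yE.
(* [y] and the finitely many [g e] are written with one exponent and one support. *)
have [|k [s [[us sD] lP]]] := @pure_span_rep_seq p R B K a D (y :: [seq g e | e <- I n]).
  by move=> u; rewrite inE => /orP[/eqP -> //|/mapP[e _ ->]].
have [b' [r' yk]] := lP y (mem_head _ _).
have /choice[br brP] (e : B) : exists br : B * (nat * K -> R), e \in I n ->
    g e *+ p ^ k = pembed p br.1 + \sum_(j <- s) br.2 j *: a j.1 j.2.
  have [eI|] := boolP (e \in I n); last by exists (0, fun=> 0).
  have [|b [r gk]] := lP (g e); first by rewrite inE map_f ?orbT.
  by exists (b, r).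
pose b e := (br e).1; pose r e := (br e).2.
have gk e : e \in I n ->
  g e *+ p ^ k = pembed p (b e) + \sum_(j <- s) r e j *: a j.1 j.2 by exact: brP.
pose var (jc : (nat * K) * B) := (jc.1.1, jc.2, jc.1.2).
(* The factor multiplying [x_ (var jc)] when all terms of the relation are moved to one side; [T0]
   collects the terms that come from [B]. *)
pose slope (jc : (nat * K) * B) : seq (B * seq (nat * B * K)) :=
  [seq (r e jc.1 *: jc.2, [:: (n, e, al)]) | e <- I n] ++
  [:: (- (r' jc.1 *: jc.2), [::])].
have slopeE jc : poly_padic x_ (slope jc) =
    \sum_(e <- I n) pscale (x_ (n, e, al)) (pembed p (r e jc.1 *: jc.2)) -
    pembed p (r' jc.1 *: jc.2).
  by rewrite poly_padic_cat /poly_padic big_map big_seq1 /mono_padic /= raddfN.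
have slope_vars jc v : v \in pvars (slope jc) -> exists e, v = (n, e, al).
  by rewrite pvars_cat pvars_linear cats0 => /mapP[e _ ->]; exists e.
pose T0 : seq (B * seq (nat * B * K)) :=
  [seq (b e, [:: (n, e, al)]) | e <- I n] ++ [:: (- b', [::])].
have T0E : poly_padic x_ T0 =
    \sum_(e <- I n) pscale (x_ (n, e, al)) (pembed p (b e)) - pembed p b'.
  by rewrite poly_padic_cat /poly_padic big_map big_seq1 /mono_padic /= raddfN.
have T0_vars v : v \in pvars T0 -> exists e, v = (n, e, al).
  by rewrite pvars_cat pvars_linear cats0 => /mapP[e _ ->]; exists e.
pose pairs : seq ((nat * K) * B) :=
  [seq (j, c) | j <- s, c <- (I j.1 : seq B)].
have upairs : uniq pairs.
  rewrite allpairs_uniq_dep // => [j _|[j c] [j' c'] _ _ /= [-> ->]//].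
  exact: fset_uniq.
have big_pairs (G : (nat * K) * B -> pcompl p B) :
    \sum_(jc <- pairs) G jc = \sum_(j <- s) \sum_(c <- I j.1) G (j, c).
  exact: big_allpairs_dep.
have relation : poly_padic x_ T0 +
    \sum_(jc <- pairs) pscale (x_ (var jc)) (poly_padic x_ (slope jc)) = 0.
  have := yk; rewrite yE -sumrMnl.
  rewrite (eq_big_seq (fun e => pscale (x_ (n, e, al)) (pembed p (b e)) +
    \sum_(jc <- pairs) pscale (x_ (var jc))
      (pscale (x_ (n, e, al)) (pembed p (r e jc.1 *: jc.2))))); last first.
    move=> e eI; rewrite -raddfMn gk // raddfD; congr (_ + _).
    rewrite raddf_sum big_pairs; apply: eq_bigr => j _.
    rewrite scale_a raddf_sum /=; apply: eq_bigr => c _.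
    by rewrite pscaleC.
  move=> /eqP; rewrite -subr_eq0 big_split => /eqP E0; rewrite -[RHS]E0.
  rewrite T0E -addrA opprD [RHS]addrACA -[RHS]addrA; congr (_ + (_ + _)).
  rewrite exchange_big /=.
  have -> : \sum_(j <- s) r' j *: a j.1 j.2 =
      \sum_(jc <- pairs) pscale (x_ (var jc)) (pembed p (r' jc.1 *: jc.2)).
    by rewrite big_pairs; apply: eq_bigr => j _; rewrite scale_a.
  rewrite -sumrB; apply: eq_bigr => jc _.
  by rewrite slopeE raddfB raddf_sum.
have slope0 jc : jc \in pairs -> jc.1 != (n, al) ->
    (forall e, e \in I n -> r e jc.1 *: jc.2 = 0) /\ r' jc.1 *: jc.2 = 0.
  move=> jcP jcn; apply: (@row_independence n al).
  apply/eqP; rewrite -subr_eq0 -slopeE; apply/eqP.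
  have var_row e : var jc <> (n, e, al).
    by move=> E; case/eqP: jcn; case: jc E {jcP} => [[m be] c] /= [-> _ ->].
  apply: (x_ind (v0 := var jc) (Q := T0 ++
    flatten [seq mulX (var j) (slope j) | j <- rem jc pairs])).
  - by apply/negP => /slope_vars[e]; exact: var_row.
  - rewrite pvars_cat mem_cat; apply/norP; split.
      by apply/negP => /T0_vars[e]; exact: var_row.
    apply/negP => /flatten_mapP[m /flatten_mapP[j jr]].
    move=> /mapP[m' m's ->] /=; rewrite inE => /orP[/eqP E|vm].
      move: jr; rewrite mem_rem_uniq // inE => /andP[/eqP + _]; apply.
      by case: j jc E {jcP jcn var_row m's} => [[? ?] ?] [[? ?] ?] [-> -> ->].
    have [|e E] := @slope_vars j (var jc); last exact: var_row E.
    by apply/flatten_mapP; exists m'.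
  rewrite (poly_padic_cat _ T0) addrCA -[RHS]relation; congr (_ + _).
  rewrite [RHS](big_rem jc) //=; congr (_ + _).
  rewrite /poly_padic big_flatten big_map; apply: eq_bigr => j _.
  by rewrite -[in LHS](cats0 (mulX _ _)) [LHS]poly_padic_mulX
    /poly_padic big_nil addr0.
have other0 (q : nat * K -> R) :
    (forall jc, jc \in pairs -> jc.1 != (n, al) -> q jc.1 *: jc.2 = 0) ->
    \sum_(j <- s) q j *: a j.1 j.2 =
    (if (n, al) \in s then q (n, al) else 0) *: a n al.
  move=> q0; have z j : j \in s -> j != (n, al) -> q j *: a j.1 j.2 = 0.
    move=> js jn; apply: scale_a_eq0 => c cI; apply: (q0 (j, c)) => //.
    by apply/allpairsPdep; exists j, c.
  case: ifP => ns.
    rewrite (big_rem (n, al)) //= big_seq big1 ?addr0 // => j jr.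
    apply: z; first exact: mem_rem jr.
    by move: jr; rewrite mem_rem_uniq // inE => /andP[].
  rewrite scale0r big_seq big1 // => j js; apply: z => //.
  by apply/eqP => E; rewrite -E js in ns.
(* If (n, al) does not occur in the support, the coefficients are 0; if it does, [al] lies in
   [D]. *)
exists k, b, (fun e => if (n, al) \in s then r e (n, al) else 0), b',
  (if (n, al) \in s then r' (n, al) else 0); split.
- move=> e eI; rewrite gk // (other0 (r e)) // => jc jcP jcn.
  by have [h _] := slope0 jc jcP jcn; exact: h.
- rewrite yk (other0 r') // => jc jcP jcn.
  by have [] := slope0 jc jcP jcn.
- case: ifP => ns; last by right.
  by left; exact: (sD _ ns).
Qed.

Section Homomorphism.
Variables (A D : set K) (phi : {additive groupG p a A -> groupG p a D}).

Let g (b : B) : pcompl p B := pgval (phi (gembed a A b)).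

Let gP b : g b \in pure_span p (generatorsG a D).
Proof. exact: pgval_mem. Qed.

(* [phi] extends to a [J_p]-linear map of the completions. *)
Lemma hom_generator n al (Aal : A al) :
  pgval (phi (PureGroup (generator_mem a n Aal))) =
  \sum_(b <- I n) pscale (x_ (n, b, al)) (g b).
Proof.
set x := PureGroup _; apply/eqP; rewrite -subr_eq0; apply/eqP.
apply: pcompl_reduced => m.
have /choice[k kP] (b : B) := pscale_approx p_pr tfB (x_ (n, b, al)) m.
(* An integer combination of elements of [B] congruent to the generator modulo p^m. By purity the
   difference is divisible by p^m inside the group, so [phi] preserves the congruence. *)
pose y := \sum_(b <- I n) gembed a A b *~ k b.
have yE : pgval y = \sum_(b <- I n) pembed p b *~ k b.
  rewrite /y raddf_sum.
  by apply: eq_bigr => b _; rewrite raddfMz.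
have [z zE] : exists z, x - y = z *+ p ^ m.
  have [u _ uE] : pmultiples p m (pgval x - pgval y).
    by rewrite yE /= -sumrB; apply: pmultiples_sum => b; exact: kP.
  by apply: (@pure_group_div _ _ _ _ _ _ _ u); rewrite raddfB uE.
have -> : x = y + z *+ p ^ m by rewrite -zE addrC subrK.
rewrite !raddfD !raddfMn /=.
rewrite addrAC; apply: pmultiplesD; last by exists (pgval (phi z)).
rewrite /y !raddf_sum -big_split /=; apply: pmultiples_sum => b.
rewrite !raddfMz -opprB; apply: pmultiplesN; exact: kP.
Qed.

Hypothesis A0 : A !=set0.

(** As [b] lies in two sets [I n] and [I n'] with n < n', a multiple of [g b] has representations
    using only row [n] and only row [n']. These rows have no variable in common, so the part in row
    [n] vanishes, and [B] is pure in the completion. *)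
Lemma hom_embeds b : exists c, g b = pembed p c.
Proof.
have [al Aal] := A0.
have [n [_ bn _]] := I_cof b b 0%N; have [n' [nn' bn' _]] := I_cof b b n.+1.
have [k [b1 [r1 [_ [_ [h1 _ _]]]]]] :=
  generator_relation gP (pgval_mem _) (hom_generator n Aal).
have [k' [b2 [r2 [_ [_ [h2 _ _]]]]]] :=
  generator_relation gP (pgval_mem _) (hom_generator n' Aal).
have {}h1 := h1 _ bn; have {}h2 := h2 _ bn'.
have r0 : forall c, c \in I n -> r1 b *: c = 0.
  (* Coefficients of the difference of the two representations after multiplying them by p^k' and
     p^k. *)
  pose c (v : nat * B * K) : B := if v.1.1 == n then r1 b *: v.1.2 *+ p ^ k'
    else - (r2 b *: v.1.2 *+ p ^ k).
  have nn : (n' == n) = false by apply/eqP; lia.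
  have us : uniq (row n al ++ row n' al).
    rewrite cat_uniq !row_uniq andbT; apply/hasPn => v /mapP[e _ ->].
    by apply/negP => /mapP[e' _ [E _]]; rewrite E eqxx in nn.
  have [|c0 _ e eI] := @linear_independence _ c (b2 b *+ p ^ k - b1 b *+ p ^ k') us.
    have E1 : \sum_(e <- I n) pscale (x_ (n, e, al)) (pembed p (c (n, e, al))) =
        (g b *+ p ^ k - pembed p (b1 b)) *+ p ^ k'.
      rewrite h1 addrAC subrr add0r scale_a -sumrMnl; apply: eq_bigr => e _.
      by rewrite /c eqxx !raddfMn.
    have E2 : \sum_(e <- I n') pscale (x_ (n', e, al)) (pembed p (c (n', e, al))) =
        - ((g b *+ p ^ k' - pembed p (b2 b)) *+ p ^ k).
      rewrite h2 addrAC subrr add0r scale_a -sumrMnl -sumrN; apply: eq_bigr => e _.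
      by rewrite /c /= nn !raddfN !raddfMn.
    rewrite big_cat !big_map /= E1 E2 !mulrnBl -!mulrnA [(p ^ k' * _)%N]mulnC.
    by rewrite opprB addrC addrA subrK raddfB !raddfMn.
  apply: (tfB (expp_gt0 k')).
  have : c (n, e, al) = 0 by apply: c0; rewrite mem_cat map_f.
  by rewrite /c eqxx.
rewrite scale_a_eq0 // addr0 in h1.
exact: (pembed_pure p_pr tfB h1).
Qed.

(** Since [g] takes values in [B], the relation for the image of the generator is linear in one row,
    and its coefficients can be compared. The scalar may still depend on [n] and [al]. *)
Lemma hom_locally_scalar : exists psi : B -> B,
  (forall b, g b = pembed p (psi b)) /\
  forall n al, A al -> exists k rho,
    (forall e, e \in I n -> psi e *+ p ^ k = rho *: e) /\ (D al \/ rho = 0).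
Proof.
have /choice[psi psiE] := hom_embeds; exists psi; split=> // n al Aal.
have yE := hom_generator n Aal.
have [k [_ [_ [b [rho [_ yk Drho]]]]]] :=
  generator_relation gP (pgval_mem _) yE.
exists k, rho; split=> // e eI.
apply/eqP; rewrite -subr_eq0; apply/eqP.
have [|c0 _] := @row_independence n al (fun e => psi e *+ p ^ k - rho *: e) b.
  move/eqP: yk; rewrite -subr_eq => /eqP <-.
  rewrite yE -sumrMnl scale_a -sumrB; apply: eq_bigr => c _.
  by rewrite psiE -raddfMn -raddfB -raddfMn -raddfB.
exact: c0.
Qed.

End Homomorphism.

Lemma hom_eq_zeroP (A D : set K) : A !=set0 -> ~ A `<=` D -> hom_eq_zero a A D.
Proof.
move=> A0 AD phi x; have [psi [psiE loc]] := hom_locally_scalar phi A0.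
have [al [Aal nDal]] : exists al, A al /\ ~ D al.
  by move/existsNP: AD => [al /not_implyP[]]; exists al.
apply: pgval_inj; move: x; apply: (eq0_on_dense p_pr tfB).
  by move=> x y; rewrite !raddfB.
move=> b; rewrite psiE; have [n [_ bn _]] := I_cof b b 0%N.
have [k [rho [/(_ b bn) psib [//|rho0]]]] := loc n al Aal.
have -> : psi b = 0 by apply: (tfB (expp_gt0 k)); rewrite psib rho0 scale0r.
exact: raddf0.
Qed.

(** The local scalars agree because each [b] shares some [I n] with [e1], and the action on [e1]
    determines the scalar; this also gives uniqueness. *)
Lemma hom_eq_ringP (A D : set K) : A !=set0 -> A `<=` D -> hom_eq_ring a A D.
Proof.
move=> A0 AD; split=> [r|phi].
  pose h (x : groupG p a A) : groupG p a D :=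
    PureGroup (scale_pure_span r AD (pgval_mem x)).
  have hB : zmod_morphism h.
    by move=> x y; apply: pgval_inj; rewrite raddfB /= -scalerBr.
  pose phi : {additive groupG p a A -> groupG p a D} :=
    HB.pack h (GRing.isZmodMorphism.Build _ _ h hB).
  by exists phi.
have [psi [psiE loc]] := hom_locally_scalar phi A0.
have [al Aal] := A0.
have scal b : exists r, psi e1 = r *: e1 /\ psi b = r *: b.
  have [n [_ e1n bn]] := I_cof e1 b 0%N.
  have [k [rho [psik _]]] := loc n al Aal.
  have [r rhoE] := e1_div (psik _ e1n); exists r.
  by split; apply: (mulrnI_tf tfB (expp_gt0 k)); rewrite psik // rhoE scalerMnl.
have [r [re1 _]] := scal e1; exists r; split.
  move=> x; apply/eqP; rewrite -subr_eq0; apply/eqP; move: x.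
  apply: (eq0_on_dense p_pr tfB).
    by move=> x y; rewrite !raddfB [RHS]addrACA.
  move=> b; rewrite psiE /= scale_pembed.
  have [q [qe1 ->]] := scal b; suff -> : q = r by rewrite subrr.
  apply/eqP; rewrite -subr_eq0; apply/eqP/e1_free.
  by rewrite scalerBl -qe1 -re1 subrr.
move=> q qE; apply/eqP; rewrite -subr_eq0; apply/eqP/e1_free.
rewrite scalerBl -re1; apply: pembed_eq0; rewrite raddfB /= -psiE qE /=.
by rewrite scale_pembed subrr.
Qed.

End Rigidity.

Theorem theorem3p5
  (p : nat) (R : pzRingType) (B : lmodType R) (K : Type)
  (d : measure_display) (T : measurableType d) (F : realType)
  (P : probability T F)
  (I : nat -> T -> {fset B}) (a : seq bool -> T -> nat)
  (f : nat * B * K -> nat -> bool) :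
  prime p ->
  countable [set: R] -> p_reduced p R -> torsion_free R ->
  free_module B -> (exists b : B, b != 0) -> countably_generated B ->
  ([set: K] #= [set: nat -> bool])%card ->
  (forall n, discrete_rv (I n)) ->
  (forall n w, I n w != fset0) ->
  independent_rvs P I -> identically_distributed P I ->
  (forall n (E : {fset B}), E != fset0 ->
     (0 < P [set w | (E `<=` I n w)%fset])%E) ->
  (forall s, discrete_rv (a s)) ->
  (forall s, uniform_below P (p ^ (2 ^ (size s).+1 - 2 ^ size s))%N (a s)) ->
  independent_rvs P a ->
  injective f ->
  {ae P, forall w : T,
     let xi_ n b al := xi p (fun k => a (mkseq (f (n, b, al)) k) w) in
     let a_ n al := \sum_(b <- I n w) pscale (xi_ n b al) (pembed p b) in
     forall A D : set K, A !=set0 -> D !=set0 ->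
       (A `<=` D -> hom_eq_ring a_ A D) /\
       (~ A `<=` D -> hom_eq_zero a_ A D)}.
Proof.
move=> p_pr cR rR tfR freeB B0 cgB _ I_rv _ I_ind I_id I_pos a_rv a_unif a_ind f_inj.
have tfB := free_torsion_free tfR freeB.
have rB := free_p_reduced rR freeB.
have cB := countably_generated_countable cR cgB.
have [e1 [e1_free e1_div]] := free_basis_vector freeB B0.
have xi_ae := xi_independent p_pr tfB cB a_rv a_unif a_ind.
have I_ae := cofinally_contained cB I_rv I_ind I_id I_pos.
apply: filterS2 xi_ae I_ae => w x_ind I_cof /= A D A0 D0.
(* Polynomials need variables with decidable equality, which [{classic K}] provides for the bare
   type [K]. *)
pose f' : nat * B * {classic K} -> nat -> bool := f.
have f'_inj : injective f' by exact: f_inj.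
pose x_ v : Jp p := xi_at p a w (f' v).
have x_ind' (S Q : seq (B * seq (nat * B * {classic K}))) v0 :
    v0 \notin pvars S -> v0 \notin pvars Q ->
    pscale (x_ v0) (poly_padic x_ S) + poly_padic x_ Q = 0 ->
    poly_padic x_ S = 0.
  (* Injectivity of [f'] keeps [v0] distinct from the other variables after they are renamed to
     sequences. *)
  move=> v0S v0Q; have := x_ind [seq (m.1, map f' m.2) | m <- S]
    [seq (m.1, map f' m.2) | m <- Q] (f' v0).
  by rewrite !pvars_map !mem_map // !poly_padic_map; apply.
split=> AD.
  exact: (hom_eq_ringP p_pr tfB rB x_ind' I_cof e1_free e1_div A0 AD).
exact: (hom_eq_zeroP p_pr tfB rB x_ind' I_cof A0 AD).
Qed.
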